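(* Suppose the Böttcher case ($p_0=p_1=0$) and that $X_1$ has a tail of index $\theta>2$, i.e. $\mathbf{P}(X_1\ge x)\sim ax^{-\theta}$ as $x\to\infty$ for some $a>0$. If $\varepsilon_n>0$ satisfy $\varepsilon_nm^{n/2}n^{-1/(2\beta)}\to\infty$, then \[\lim_{n\to\infty}\varepsilon_n^\theta m^{(\theta-1)n}\mathbf{P}(R_n\ge\varepsilon_n)=aI_\theta,\qquad I_\theta:=\frac1{\Gamma(\theta-1)}\int_0^\infty\varphi(v)v^{\theta-2}\,dv.\]
   Context: Standing setup: $Z=(Z_n)_{n\ge0}$ is a Galton–Watson process with $Z_0=1$ and offspring law $\{p_k\}$ with mean $m\in(1,\infty)$ and $\mathbf{E}Z_1\log Z_1<\infty$. Independently, $(X_n)$ are i.i.d. with $\mathbf{E}X_1=0$, $\mathbf{E}X_1^2\in(0,\infty)$; $S_k:=X_1+\dots+X_k$; $R_n:=S_{Z_n}/Z_n$ on $\{Z_n>0\}$, and $\mathbf{P}(R_n\ge x)$ means $\mathbf{P}(R_n\ge x,Z_n>0)$. Böttcher case: $p_0+p_1=0$; $\mu:=\min\{k:p_k>0\}\ge2$ and $\beta\in(0,1)$ is defined by $\mu=m^\beta$. $W:=\lim_nm^{-n}Z_n$ a.s. and $\varphi(h):=\mathbf{E}e^{-hW}$. *)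

(* Defs.v *)
From HB Require Import structures.
From mathcomp Require Import all_boot all_order all_algebra.
From mathcomp Require Import all_classical all_reals all_analysis.
Set Implicit Arguments. Unset Strict Implicit. Unset Printing Implicit Defensive.
Import Order.TTheory GRing.Theory Num.Theory.
Import numFieldNormedType.Exports.
Local Open Scope classical_set_scope.
Local Open Scope ring_scope.

Definition mutually_independent {d} {T : measurableType d} {R : realType}
  (P : probability T R) {I : eqType} (Y : I -> T -> R) : Prop :=
  (forall i, measurable_fun setT (Y i)) /\
  forall (s : seq I) (B : I -> set R),
    uniq s -> (forall i, measurable (B i)) ->
    P (\big[setI/setT]_(i <- s) (Y i @^-1` B i)) =
    (\prod_(i <- s) P (Y i @^-1` B i))%E.

Definition Gamma_fun {R : realType} (s : R) : \bar R :=
  (\int[@lebesgue_measure R]_(x in `]0%R, +oo[) (x `^ (s - 1) * expR (- x))%:E)%E.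

(* Galton–Watson population sizes built from offspring counts xi n i
   (number of children of the i-th individual of generation n):
   Z_0 = 1, Z_{n+1} = sum_{i < Z_n} xi n i. *)
Fixpoint GW_Z {T : Type} (xi : nat -> nat -> T -> nat) (n : nat) (w : T) : nat :=
  match n with
  | 0 => 1
  | n'.+1 => \sum_(i < GW_Z xi n' w) xi n' i w
  end.

(* Partial sums S_k = X_0 + ... + X_{k-1} (X_0 plays the role of the
   paper's X_1). *)
Definition psum {T : Type} {R : realType} (X : nat -> T -> R) (k : nat) (w : T) : R :=
  \sum_(i < k) X i w.

(* Main.v *)
(* Conditioning on [Z_n], the probability is
   [E P(S_k >= eps_n k)] at [k = Z_n]. For a tail of index [theta > 2],
   [P(S_k >= x) ~ k P(X_1 >= x)] uniformly in [x^2 / (k ln x)] large: either one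
   step exceeds [(1 - delta) x], or one exceeds [eta x] and the others contribute
   [delta x] (Chebyshev), or all steps stay below [eta x] (exponential moment of
   the truncated steps at [h = (theta + 1) ln x / x]); Bonferroni gives the
   converse. This turns the probability into
   [a eps_n^(-theta) m^(-(theta - 1) n) E (Z_n / m^n)^(1 - theta)].
   With [phi_n(h) = E exp(- h Z_n / m^n)] and [f] the offspring generating
   function, [phi_(n+1)(m h) = f(phi_n(h)) <= phi_n(h)^mu] and the [L log L]
   condition yield [phi_n(h) <= exp(- c h^beta)] uniformly in [n]. This bound
   dominates in [E (Z_n / m^n)^(1 - theta) =
   Gamma(theta - 1)^(-1) int phi_n(v) v^(theta - 2) dv], so this converges, and it
   makes the event [eps_n^2 Z_n < M n], where the first step fails, negligible
   (Chernoff); the growth condition on [eps_n] is exactly what this needs. *)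
Require Import Defs.
From HB Require Import structures.
From mathcomp Require Import all_boot all_order all_algebra.
From mathcomp Require Import all_classical all_reals all_analysis.
From mathcomp Require Import measurable_realfun ring lra.
Import Order.TTheory GRing.Theory Num.Theory.
Import numFieldNormedType.Exports.
Set Implicit Arguments. Unset Strict Implicit. Unset Printing Implicit Defensive.
Local Open Scope classical_set_scope.
Local Open Scope ring_scope.

(** * Independence of disjoint blocks of an independent family *)

(** The delicate range is [eps_n^2 Z_n < M n]. The normalisation [m^((theta - 1) n)] grows
    exponentially, so this event needs an exponentially small probability. At
    [h = (lambda n)^(1/beta)] the Laplace transform of [Z_n / m^n] is at most [exp(- c lambda n)],
    with [lambda] free to beat the normalisation. The Chernoff factor [exp(h y)],
    [y = M n / (eps_n^2 m^n)], costs at most [exp(n)] once [eps_n^2 m^n] dominates [n^(1/beta)]: the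
    growth condition squared. The threshold [M n] comes from the walk: at [x = eps_n k] the ratio
    [x^2 / k] is [eps_n^2 k], and it must dominate [ln x], which involves [ln k], of order [n] for
    [k] near [m^n]. The decay of [phi_n] needs a fixed starting point: some [h] with [phi_n(h)]
    bounded away from 1 for all [n], which is what L log L provides. Each further generation raises
    to the power [mu] while the argument is multiplied by [m]; [j] generations give the exponent
    [mu^j = (m^j)^beta]. Conditioning on [Z_n] is done by summing over its values. *)

Section independence.
Context {d : measure_display} {T : measurableType d} {R : realType}.
Variable P : probability T R.
Context {I : eqType}.
Variable Y : I -> T -> R.
Hypothesis HY : mutually_independent P Y.

(** A pi-system generating the sigma-algebra of the [Y i] with [i] in [A]. Duplicate-free lists
    match the form of [mutually_independent]. *)
Definition cylinders (A : set I) : set (set T) :=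
  [set E | exists s, exists B : I -> set R,
    [/\ uniq s, (forall i, i \in s -> A i), (forall i, measurable (B i)) &
        E = \big[setI/setT]_(i <- s) (Y i @^-1` B i)]].

(** Measurability with respect to the sigma-algebra of a block is obtained by changing the structure
    on the source, so the general closure properties of [measurable_fun] apply to it unchanged. *)
Definition sub_measurable (A : set I) (d' : measure_display)
    (T' : measurableType d') (U : T -> T') :=
  @measurable_fun _ _ (g_sigma_algebraType (cylinders A)) T' setT U.

Lemma in_bigsetI (s : seq I) (F : I -> set T) w :
  (\big[setI/setT]_(i <- s) F i) w <-> (forall i, i \in s -> F i w).
Proof.
elim: s => [|j s IH]; first by rewrite big_nil.
rewrite big_cons; split=> [[h1 /IH h2] i|h].
  by rewrite inE => /predU1P[->|/h2].
split; first by apply: h; rewrite mem_head.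
by apply/IH => i si; apply: h; rewrite inE si orbT.
Qed.

(** The two lists may share indices, so they are merged without duplicates and an index absent from
    one list gets [setT] there. *)
Lemma cylinders_setI A : setI_closed (cylinders A).
Proof.
move=> E F [s1 [B1 [u1 A1 m1 ->]]] [s2 [B2 [u2 A2 m2 ->]]].
exists (undup (s1 ++ s2)).
exists (fun i => (if i \in s1 then B1 i else setT) `&`
                 (if i \in s2 then B2 i else setT)).
split; first exact: undup_uniq.
- by move=> i; rewrite mem_undup mem_cat => /orP[/A1|/A2].
- by move=> i; apply: measurableI; case: ifP.
apply/seteqP; split=> w.
  move=> [/in_bigsetI h1 /in_bigsetI h2]; apply/in_bigsetI => i _.
  by split=> /=; case: ifP => // ?; [apply: h1|apply: h2].
move=> /in_bigsetI h; split; apply/in_bigsetI => i si.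
  by have [] := h i _; rewrite ?mem_undup ?mem_cat ?si// => + _.
by have [] := h i _; rewrite ?mem_undup ?mem_cat ?si ?orbT// => _ +.
Qed.

Lemma cylinders_measurable A E : cylinders A E -> measurable E.
Proof.
move=> [s [B [_ _ mB ->]]]; apply: bigsetI_measurable => i _.
by rewrite -[X in measurable X]setTI; apply: HY.1.
Qed.

Lemma sigma_cylinders_measurable A E : <<s cylinders A >> E -> measurable E.
Proof.
apply: smallest_sub; first exact: sigma_algebra_measurable.
by move=> F; exact: cylinders_measurable.
Qed.

Lemma cylinders_indep A B E F : A `&` B `<=` set0 ->
  cylinders A E -> cylinders B F -> P (E `&` F) = (P E * P F)%E.
Proof.
move=> AB [s1 [B1 [u1 A1 m1 ->]]] [s2 [B2 [u2 A2 m2 ->]]].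
pose C i := if i \in s1 then B1 i else B2 i.
have C1 i : i \in s1 -> C i = B1 i by rewrite /C => ->.
have C2 i : i \in s2 -> C i = B2 i.
  rewrite /C; case: ifP => // i1 i2.
  by have := AB i (conj (A1 _ i1) (A2 _ i2)).
have -> : \big[setI/setT]_(i <- s1) (Y i @^-1` B1 i) =
          \big[setI/setT]_(i <- s1) (Y i @^-1` C i).
  by apply: eq_big_seq => i /C1 ->.
have -> : \big[setI/setT]_(i <- s2) (Y i @^-1` B2 i) =
          \big[setI/setT]_(i <- s2) (Y i @^-1` C i).
  by apply: eq_big_seq => i /C2 ->.
have mC i : measurable (C i) by rewrite /C; case: ifP.
rewrite -big_cat/= !HY.2 ?big_cat//.
rewrite cat_uniq u1 u2 andbT /=; apply/hasPn => i i2; apply/negP => i1.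
by have := AB i (conj (A1 _ i1) (A2 _ i2)).
Qed.

Lemma indep_dynkin (F : set T) : measurable F ->
  dynkin [set E | measurable E /\ P (E `&` F) = (P E * P F)%E].
Proof.
move=> mF; have PFfin := fin_num_measure P F mF.
split => /=.
- by rewrite setTI probability_setT mul1e.
- move=> E [mE EF]; split; first exact: measurableC.
  have PF : P F = (P (~` E `&` F) + P E * P F)%E.
    by rewrite -EF setIC -setDE [E `&` F]setIC; exact: measureDI.
  rewrite probability_setC//.
  have PEfin := fin_num_measure P E mE.
  rewrite muleBl// ?mul1e.
  by rewrite {1}PF addeK// fin_numM.
- move=> S tS PS.
  have mS i : measurable (S i) by have [] := PS i.
  have mU : measurable (\bigcup_n S n) by exact: bigcupT_measurable.
  split; first exact: mU.
  rewrite setI_bigcupl !measure_semi_bigcup//; last 3 first.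
  + by move=> i; exact: measurableI.
  + by apply: trivIset_setIr.
  + by apply: bigcupT_measurable => i; exact: measurableI.
  rewrite muleC -(fineK PFfin) -nneseriesZl//.
  apply: eq_eseriesr => i _; rewrite (fineK PFfin) muleC.
  by have [_] := PS i.
Qed.

(** Dynkin's pi-lambda theorem, applied twice: with [F] fixed, [E] is reduced to a cylinder, and
    then with this cylinder fixed, [F] is. *)
Lemma sigma_cylinders_indep A B E F : A `&` B `<=` set0 ->
  <<s cylinders A >> E -> <<s cylinders B >> F ->
  P (E `&` F) = (P E * P F)%E.
Proof.
move=> AB; rewrite -setI_closed_g_dynkin_g_sigma_algebra; last first.
  exact: cylinders_setI.
move=> sE sF; have mF := sigma_cylinders_measurable sF.
have [|//] := smallest_sub (indep_dynkin mF) _ sE.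
move=> {sE}E cE /=; have mE := cylinders_measurable cE; split=> //.
move: sF; rewrite -setI_closed_g_dynkin_g_sigma_algebra; last first.
  exact: cylinders_setI.
move=> sF; rewrite setIC muleC.
have [|//] := smallest_sub (indep_dynkin mE) _ sF.
move=> {mF sF}F cF /=; split; first exact: cylinders_measurable cF.
by rewrite setIC muleC; exact: cylinders_indep AB cE cF.
Qed.

Lemma sub_measurable_indep A B (d1 d2 : measure_display)
    (T1 : measurableType d1) (T2 : measurableType d2)
    (U : T -> T1) (V : T -> T2) (C : set T1) (D : set T2) :
  A `&` B `<=` set0 -> sub_measurable A U -> sub_measurable B V ->
  measurable C -> measurable D ->
  P (U @^-1` C `&` V @^-1` D) = (P (U @^-1` C) * P (V @^-1` D))%E.
Proof.
move=> AB mU mV mC mD; apply: (sigma_cylinders_indep AB).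
  by have := mU measurableT _ mC; rewrite setTI.
by have := mV measurableT _ mD; rewrite setTI.
Qed.

Lemma sub_measurable_fun A (d1 : measure_display)
    (T1 : measurableType d1) (U : T -> T1) :
  sub_measurable A U -> measurable_fun setT U.
Proof.
move=> mU _ C mC; apply: (@sigma_cylinders_measurable A).
exact: mU.
Qed.

Lemma sub_measurable_proj (A : set I) i : A i -> sub_measurable A (Y i).
Proof.
move=> Ai _ C mC; rewrite setTI; apply: sub_gen_smallest.
exists [:: i], (fun=> C); split=> //; first by move=> j; rewrite inE => /eqP ->.
by rewrite big_seq1.
Qed.

Lemma sub_measurableW (A B : set I) (d1 : measure_display)
    (T1 : measurableType d1) (U : T -> T1) :
  A `<=` B -> sub_measurable A U -> sub_measurable B U.
Proof.
move=> AB mU _ C mC; have := mU measurableT _ mC.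
rewrite !setTI; apply: smallest_sub; first exact: smallest_sigma_algebra.
move=> E [s [D [us As mD ->]]]; apply: sub_gen_smallest.
by exists s, D; split => // i /As/AB.
Qed.

(** The joint law agrees with the product law on rectangles, hence everywhere, and Tonelli's theorem
    splits the integral. Arbitrary target spaces are allowed because the next use takes [T] itself
    with a smaller sigma-algebra as target. *)
Lemma ge0_integral_indepM (d1 d2 : measure_display)
    (T1 : measurableType d1) (T2 : measurableType d2)
    (U : {mfun T >-> T1}) (V : {mfun T >-> T2}) (f : T1 -> R) (g : T2 -> R) :
  (forall C D, measurable C -> measurable D ->
    P (U @^-1` C `&` V @^-1` D) = (P (U @^-1` C) * P (V @^-1` D))%E) ->
  measurable_fun setT f -> measurable_fun setT g ->
  (forall x, 0 <= f x) -> (forall x, 0 <= g x) ->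
  (\int[P]_w (f (U w) * g (V w))%:E =
   \int[P]_w (f (U w))%:E * \int[P]_w (g (V w))%:E)%E.
Proof.
move=> UVindep mf mg f0 g0.
pose UV w := (U w, V w).
have mUV : measurable_fun setT UV by apply: measurable_fun_pair.
pose mfUV := MeasurableFun.Pack
  (MeasurableFun.Class (isMeasurableFun.Build _ _ _ _ _ mUV)).
have E C D : measurable C -> measurable D ->
    distribution P mfUV (C `*` D) = (distribution P U C * distribution P V D)%E.
  by move=> mC mD; rewrite -(UVindep _ _ mC mD).
have E' := product_measure_unique E.
pose F (x : T1 * T2) := (f x.1 * g x.2)%:E.
have mF : measurable_fun setT F.
  by apply/measurable_EFinP; apply: measurable_funM; apply: measurableT_comp.
have F0 x : (0 <= F x)%E by rewrite lee_fin mulr_ge0.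
transitivity (\int[distribution P mfUV]_x F x)%E.
  by rewrite ge0_integral_distribution.
transitivity (\int[(distribution P U \x distribution P V)%E]_x F x)%E.
  by apply: eq_measure_integral => C mC _; rewrite -E'.
rewrite fubini_tonelli1//= /fubini_F.
have emf : measurable_fun setT (EFin \o f) by exact/measurable_EFinP.
have emg : measurable_fun setT (EFin \o g) by exact/measurable_EFinP.
transitivity (\int[distribution P U]_x ((f x)%:E * \int[P]_w (g (V w))%:E))%E.
  apply: eq_integral => x _.
  under eq_integral do rewrite /F /= EFinM.
  rewrite ge0_integralZl//; last 2 first.
    by move=> * /=; rewrite lee_fin.
    by rewrite lee_fin.
  congr (_ * _)%E; by rewrite (ge0_integral_distribution V emg)//= => *; rewrite lee_fin.
rewrite ge0_integralZr//; last 2 first.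
  by move=> * /=; rewrite lee_fin.
  by apply: integral_ge0 => *; rewrite lee_fin.
congr (_ * _)%E; by rewrite (ge0_integral_distribution U emf)//= => *; rewrite lee_fin.
Qed.

Lemma ge0_expectation_indepM A B (U V : T -> R) :
  A `&` B `<=` set0 -> sub_measurable A U -> sub_measurable B V ->
  (forall w, 0 <= U w) -> (forall w, 0 <= V w) ->
  (\int[P]_w (U w * V w)%:E = \int[P]_w (U w)%:E * \int[P]_w (V w)%:E)%E.
Proof.
move=> AB sU sV U0 V0.
(* The independent pair is the identity of [T] seen through the two sigma-algebras; [U] and [V] then
   act as the test functions. *)
have sub C : measurable_fun setT (idfun : T -> g_sigma_algebraType (cylinders C)).
  by move=> _ E sE; rewrite setTI; exact: sigma_cylinders_measurable sE.
pose mk C := MeasurableFun.Pack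
  (MeasurableFun.Class (isMeasurableFun.Build _ _ _ _ _ (sub C))).
apply: (@ge0_integral_indepM _ _ _ _ (mk A) (mk B)) => //= C D mC mD.
exact: (sigma_cylinders_indep AB).
Qed.

Lemma ge0_integral_nat_partition (N : T -> nat) (g : nat -> T -> \bar R) :
  measurable_fun setT N -> (forall k, measurable_fun setT (g k)) ->
  (forall k w, 0 <= g k w)%E ->
  (\int[P]_w g (N w) w =
   \sum_(0 <= k <oo) \int[P]_w ((\1_(N @^-1` [set k]) w)%:E * g k w))%E.
Proof.
move=> mN mg g0.
have mNk k : measurable (N @^-1` [set k]).
  by rewrite -[X in measurable X]setTI; apply: mN.
rewrite -integral_nneseries//; last 2 first.
  move=> k; apply: emeasurable_funM => //; apply/measurable_EFinP.
  exact: measurable_indic.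
  by move=> k w _; rewrite mule_ge0// lee_fin.
apply: eq_integral => w _.
rewrite (@nneseriesD1 _ _ (N w))//; last by move=> k _; rewrite mule_ge0// lee_fin.
rewrite indicE mem_set//= mul1e eseries0 ?adde0// => k _ kN.
rewrite indicE memNset ?mul0e//=; apply/eqP; rewrite eq_sym; exact: kN.
Qed.

(** Freezing of an independent index: on each event [N = k] the factor [g k] is independent of the
    indicator. It serves both the recursion for the generating function of [Z_n] and the passage
    from the stopped walk to fixed [k]. *)
Lemma ge0_expectation_subst A B (N : T -> nat) (g : nat -> T -> R) :
  A `&` B `<=` set0 -> sub_measurable A N ->
  (forall k, sub_measurable B (g k)) -> (forall k w, 0 <= g k w) ->
  (\int[P]_w (g (N w) w)%:E = \int[P]_w \int[P]_v (g (N w) v)%:E)%E.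
Proof.
move=> AB sN sg g0.
have mN := sub_measurable_fun sN.
have mg k := sub_measurable_fun (sg k).
rewrite (@ge0_integral_nat_partition N (fun k w => (g k w)%:E))//; last first.
  by move=> k; apply/measurable_EFinP; exact: mg.
rewrite (@ge0_integral_nat_partition N (fun k _ => \int[P]_v (g k v)%:E)%E)//;
  last by move=> k w; apply: integral_ge0 => *; rewrite lee_fin.
have mNk k : measurable (N @^-1` [set k]).
  by rewrite -[X in measurable X]setTI; apply: mN.
apply: eq_eseriesr => k _.
rewrite ge0_integralZr//; last 2 first.
  by apply/measurable_EFinP; exact: measurable_indic.
  by apply: integral_ge0 => *; rewrite lee_fin.
rewrite -(ge0_expectation_indepM AB)//.
apply: (@measurable_indic _ (g_sigma_algebraType (cylinders A))).
by have := sN measurableT [set k]; rewrite setTI; apply.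
Qed.

(** Mean zero means that the positive and negative parts of [V] have equal integrals, so the four
    products of parts cancel in pairs. It removes the cross terms from the variance of a sum. *)
Lemma expectation_indepM0 A B (U V : T -> R) :
  A `&` B `<=` set0 -> sub_measurable A U -> sub_measurable B V ->
  P.-integrable setT (EFin \o U) -> P.-integrable setT (EFin \o V) ->
  (\int[P]_w (V w)%:E = 0)%E ->
  P.-integrable setT (EFin \o (U \* V)) /\ (\int[P]_w (U w * V w)%:E = 0)%E.
Proof.
move=> AB sU sV iU iV V0.
have mU := sub_measurable_fun sU; have mV := sub_measurable_fun sV.
have iUV : P.-integrable setT (EFin \o (U \* V)).
  apply/integrableP; split.
    by apply/measurable_EFinP; exact: measurable_funM.
  under eq_integral do rewrite /= normrM.
  have sUn : sub_measurable A (Num.norm \o U) by exact: measurableT_comp.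
  have sVn : sub_measurable B (Num.norm \o V) by exact: measurableT_comp.
  have n0 (W : T -> R) w : 0 <= (Num.norm \o W) w by exact: normr_ge0.
  have -> := ge0_expectation_indepM AB sUn sVn (n0 U) (n0 V).
  rewrite lte_mul_pinfty//.
  - by apply: integral_ge0 => *; rewrite lee_fin.
  - rewrite ge0_fin_numE; first by case/integrableP : iU.
    by apply: integral_ge0 => w _; rewrite lee_fin.
  - by case/integrableP : iV.
split=> //.
have iVp := integrable_funrpos measurableT iV.
have iVn := integrable_funrneg measurableT iV.
have iUp := integrable_funrpos measurableT iU.
have iUn := integrable_funrneg measurableT iU.
have sUp : sub_measurable A U^\+ by exact: measurable_funrpos.
have sUn : sub_measurable A U^\- by exact: measurable_funrneg.
have sVp : sub_measurable B V^\+ by exact: measurable_funrpos.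
have sVn : sub_measurable B V^\- by exact: measurable_funrneg.
have mprod (W Z : T -> R) : sub_measurable A W -> sub_measurable B Z ->
    measurable_fun setT (EFin \o (W \* Z)).
  move=> /sub_measurable_fun mW /sub_measurable_fun mZ.
  by apply/measurable_EFinP; exact: measurable_funM.
have intprod (W Z : T -> R) : sub_measurable A W -> sub_measurable B Z ->
    (forall w, 0 <= W w <= `|U w|) -> (forall w, 0 <= Z w <= `|V w|) ->
    P.-integrable setT (EFin \o (W \* Z)).
  move=> sW sZ WU ZV; apply: le_integrable iUV => //; first exact: mprod.
  move=> w _ /=; rewrite lee_fin !normrM.
  have /andP[W0 WU'] := WU w; have /andP[Z0 ZV'] := ZV w.
  by rewrite ler_pM// ger0_norm.
have pU w : 0 <= U^\+ w <= `|U w|.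
  by rewrite /funrpos le_max lexx orbT ge_max ler_norm normr_ge0.
have nU w : 0 <= U^\- w <= `|U w|.
  by rewrite /funrneg le_max lexx orbT ge_max -normrN ler_norm normr_ge0.
have pV w : 0 <= V^\+ w <= `|V w|.
  by rewrite /funrpos le_max lexx orbT ge_max ler_norm normr_ge0.
have nV w : 0 <= V^\- w <= `|V w|.
  by rewrite /funrneg le_max lexx orbT ge_max -normrN ler_norm normr_ge0.
have eV : (\int[P]_w (V^\+ w)%:E = \int[P]_w (V^\- w)%:E)%E.
  have Vp := integrable_fin_num measurableT iVp.
  have Vn := integrable_fin_num measurableT iVn.
  have : (\int[P]_w (V^\+ w)%:E - \int[P]_w (V^\- w)%:E = 0)%E.
    rewrite -integralB_EFin// -[RHS]V0.
    by apply: eq_integral => w _; rewrite -EFinB -[in RHS](funrposBneg V).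
  move: Vp Vn => /fineK <- /fineK <-; rewrite -EFinB => -[] /eqP.
  by rewrite subr_eq0 => /eqP ->.
have addint (f g : T -> R) : P.-integrable setT (EFin \o f) ->
    P.-integrable setT (EFin \o g) -> P.-integrable setT (EFin \o (f \+ g)).
  by move=> iF iG; have := integrableD measurableT iF iG.
(* The products are grouped by sign; once they factor, [eV] makes the two groups equal. *)
have -> : (\int[P]_w (U w * V w)%:E = \int[P]_w
    ((((U^\+ \* V^\+) \+ (U^\- \* V^\-)) w)%:E -
     (((U^\+ \* V^\-) \+ (U^\- \* V^\+)) w)%:E))%E.
  apply: eq_integral => w _; rewrite -EFinB /=; congr EFin.
  rewrite -[in LHS](funrposBneg U) -[in LHS](funrposBneg V) !fctE.
  by rewrite mulrBl !mulrBr; ring.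
rewrite integralB_EFin//; last 2 first.
  by apply: addint; apply: intprod.
  by apply: addint; apply: intprod.
have g0 (W : T -> R) w : 0 <= W^\+ w :> R by exact: funrpos_ge0.
have g0' (W : T -> R) w : 0 <= W^\- w :> R by exact: funrneg_ge0.
under eq_integral do rewrite /= EFinD.
under [X in (_ - X)%E]eq_integral do rewrite /= EFinD.
rewrite !ge0_integralD//; do ?[by move=> w _; rewrite lee_fin mulr_ge0|exact: mprod].
rewrite !(ge0_expectation_indepM AB)// eV subee// fin_numD !fin_numM//.
all: exact: integrable_fin_num.
Qed.

End independence.

(** * Sums of independent and identically distributed variables *)

Section iid_sums.
Context {d : measure_display} {T : measurableType d} {R : realType}.
Variable P : probability T R.
Variable X : nat -> T -> R.
Hypothesis HX : mutually_independent P X.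
Hypothesis HX_law : forall k (B : set R), measurable B ->
  P (X k @^-1` B) = P (X 0%N @^-1` B).

Let mX k : measurable_fun setT (X k).
Proof. exact: HX.1. Qed.

Lemma ge0_integral_iid k (g : R -> \bar R) :
  measurable_fun setT g -> (forall x, 0 <= g x)%E ->
  (\int[P]_w g (X k w) = \int[P]_w g (X 0%N w))%E.
Proof.
move=> mg g0.
pose mk j := MeasurableFun.Pack
  (MeasurableFun.Class (isMeasurableFun.Build _ _ _ _ _ (mX j))).
rewrite -(ge0_integral_distribution (mk k) mg g0).
rewrite -(ge0_integral_distribution (mk 0%N) mg g0).
by apply: eq_measure_integral => B mB _; exact: HX_law.
Qed.

Lemma integrable_iid k (g : R -> R) : measurable_fun setT g ->
  P.-integrable setT (fun w => (g (X 0%N w))%:E) ->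
  P.-integrable setT (fun w => (g (X k w))%:E).
Proof.
move=> mg /integrableP[_ ig]; apply/integrableP; split.
  by apply/measurable_EFinP; exact: measurableT_comp.
rewrite (@ge0_integral_iid k (fun x => `|(g x)%:E|%E))//.
by apply: measurableT_comp => //; exact/measurable_EFinP.
Qed.

Lemma integral_iid k (g : R -> R) : measurable_fun setT g ->
  (\int[P]_w (g (X k w))%:E = \int[P]_w (g (X 0%N w))%:E)%E.
Proof.
move=> mg; have emg : measurable_fun setT (EFin \o g) by exact/measurable_EFinP.
rewrite integralE [RHS]integralE; congr (_ - _)%E.
  apply: etrans (etrans (@ge0_integral_iid k ((EFin \o g)^\+)%E
    (measurable_funepos emg) (funepos_ge0 _)) _).
    by apply: eq_integral => w _; rewrite unlock.
  by apply: eq_integral => w _; rewrite unlock.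
apply: etrans (etrans (@ge0_integral_iid k ((EFin \o g)^\-)%E
  (measurable_funeneg emg) (funeneg_ge0 _)) _).
  by apply: eq_integral => w _; rewrite unlock.
by apply: eq_integral => w _; rewrite unlock.
Qed.

Lemma sub_measurable_sum (J : seq nat) :
  sub_measurable X [set` J] (fun w => \sum_(j <- J) X j w).
Proof.
elim: J => [|j J IH].
  rewrite (_ : (fun w => _) = cst 0); first exact: measurable_cst.
  by apply/funext => w; rewrite big_nil.
rewrite (_ : (fun w => _) = (fun w => X j w + \sum_(i <- J) X i w)); last first.
  by apply/funext => w; rewrite big_cons.
apply: measurable_funD.
  by apply: sub_measurable_proj; rewrite /= mem_head.
by apply: sub_measurableW IH => i /= iJ; rewrite inE iJ orbT.
Qed.

Lemma measurable_iid_sum (J : seq nat) :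
  measurable_fun setT (fun w => \sum_(j <- J) X j w).
Proof. exact: (sub_measurable_fun HX (@sub_measurable_sum J)). Qed.

Hypothesis HX1int : P.-integrable setT (EFin \o X 0%N).
Hypothesis HX1mean : (\int[P]_w (X 0%N w)%:E = 0)%E.
Hypothesis HX2int : P.-integrable setT (EFin \o (fun w => X 0%N w ^+ 2)).

Definition second_moment : R := fine (\int[P]_w (X 0%N w ^+ 2)%:E)%E.

Lemma second_moment_ge0 : 0 <= second_moment.
Proof. by apply: fine_ge0; apply: integral_ge0 => w _; rewrite lee_fin sqr_ge0. Qed.

Lemma iid_sum_moments (J : seq nat) : uniq J ->
  [/\ P.-integrable setT (fun w => (\sum_(j <- J) X j w)%:E),
      P.-integrable setT (fun w => ((\sum_(j <- J) X j w) ^+ 2)%:E) &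
      (\int[P]_w ((\sum_(j <- J) X j w) ^+ 2)%:E =
        ((size J)%:R * second_moment)%:E)%E].
Proof.
elim: J => [_|j J IH /= /andP[jJ uJ]].
  under eq_fun do rewrite big_nil.
  split; [exact: integrable0| |].
    under eq_fun do rewrite big_nil expr0n.
    exact: integrable0.
  under eq_integral do rewrite big_nil expr0n.
  by rewrite integral0 mul0r.
have [i1 i2 e2] := IH uJ.
have iXj : P.-integrable setT (EFin \o X j).
  exact: (@integrable_iid j id).
have iXj2 : P.-integrable setT (fun w => (X j w ^+ 2)%:E).
  exact: (@integrable_iid j (fun x => x ^+ 2)).
have eXj : (\int[P]_w (X j w)%:E = 0)%E.
  by rewrite (@integral_iid j id).
have eXj2 : (\int[P]_w (X j w ^+ 2)%:E = second_moment%:E)%E.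
  rewrite (@integral_iid j (fun x => x ^+ 2))// fineK//.
  exact: integrable_fin_num.
have disj : [set` J] `&` [set j] `<=` set0.
  by move=> i [/= iJ ij]; move: jJ; rewrite -ij iJ.
have sXj : sub_measurable X [set j] (X j) by exact: sub_measurable_proj.
have [iP eP] := expectation_indepM0 HX disj (@sub_measurable_sum J) sXj i1 iXj eXj.
have iP2 : P.-integrable setT
    (fun w => ((\sum_(i <- J) X i w) * X j w *+ 2)%:E).
  have := integrableD measurableT iP iP.
  by apply: eq_integrable => // w _ /=; rewrite -EFinD mulr2n.
have eP2 : (\int[P]_w ((\sum_(i <- J) X i w) * X j w *+ 2)%:E = 0)%E.
  under eq_integral do rewrite mulr2n EFinD.
  by rewrite integralD// eP adde0.
have split2 w : (\sum_(i <- j :: J) X i w) ^+ 2 =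
    X j w ^+ 2 + (\sum_(i <- J) X i w) * X j w *+ 2 + (\sum_(i <- J) X i w) ^+ 2.
  by rewrite big_cons; ring.
split.
- under eq_fun do rewrite big_cons EFinD.
  exact: integrableD.
- under eq_fun do rewrite split2 !EFinD.
  by apply: integrableD => //; apply: integrableD.
- under eq_integral do rewrite split2 !EFinD.
  rewrite integralD//; last by apply: integrableD.
  rewrite integralD// eXj2 eP2 e2 adde0 -EFinD; congr EFin.
  by rewrite -[in RHS]natr1; ring.
Qed.

Lemma iid_sum_chebyshev (J : seq nat) (y : R) : uniq J -> 0 < y ->
  (P [set w | (y <= `|\sum_(j <- J) X j w|)%R ] <=
    ((size J)%:R * second_moment / y ^+ 2)%:E)%E.
Proof.
move=> uJ y0; have [_ _ e2] := iid_sum_moments uJ.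
pose mk := MeasurableFun.Pack
  (MeasurableFun.Class (isMeasurableFun.Build _ _ _ _ _ (measurable_iid_sum J))).
have := @markov _ _ _ P mk (fun x => x ^+ 2) y y0.
rewrite unlock /= => H.
have {H} := H _ _ _.
under [X in (_ <= X)%E]eq_integral => w _ do rewrite /= real_normK ?num_real//.
rewrite e2 => H.
rewrite mulrC EFinM lee_pdivlMl ?exprn_gt0//.
apply: le_trans (H _ _ _) => //.
- by move=> r _; exact: sqr_ge0.
- by move=> u v; rewrite !nnegrE => u0 v0 uv; rewrite ler_sqr.
Qed.

End iid_sums.

(** * Real-valued probabilities and a Bonferroni bound *)

Section probability_real.
Context {d : measure_display} {T : measurableType d} {R : realType}.
Variable P : probability T R.

(** With values in [R] rather than the extended reals, estimates are within reach of [lra] and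
    [nra]. *)
Definition prob (A : set T) : R := fine (P A).

Lemma probE A : measurable A -> P A = (prob A)%:E.
Proof. by move=> mA; rewrite fineK// fin_num_measure. Qed.

Lemma prob_ge0 A : 0 <= prob A.
Proof. exact: fine_ge0. Qed.

Lemma prob_le1 A : measurable A -> prob A <= 1.
Proof. by move=> mA; rewrite -lee_fin -probE// probability_le1. Qed.

Lemma le_prob A B : measurable A -> measurable B -> A `<=` B ->
  prob A <= prob B.
Proof. by move=> mA mB AB; rewrite -lee_fin -!probE// le_measure ?inE. Qed.

Lemma prob_setC A : measurable A -> prob (~` A) = 1 - prob A.
Proof.
move=> mA; apply: EFin_inj; rewrite -probE; last exact: measurableC.
by rewrite probability_setC// probE// EFinB.
Qed.

Lemma prob_setU A B : measurable A -> measurable B ->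
  prob (A `|` B) = prob A + prob B - prob (A `&` B).
Proof.
move=> mA mB; apply: EFin_inj; rewrite -probE; last exact: measurableU.
rewrite measureUfinr//; last first.
  by rewrite (le_lt_trans (probability_le1 P mB))// ltry.
rewrite EFinB EFinD -!probE//; exact: measurableI.
Qed.

Lemma prob_setU_le A B : measurable A -> measurable B ->
  prob (A `|` B) <= prob A + prob B.
Proof. by move=> mA mB; rewrite prob_setU// lerBlDr lerDl prob_ge0. Qed.

Lemma prob_bigsetU_le (A : nat -> set T) n (b : R) :
  (forall i, (i < n)%N -> measurable (A i)) ->
  (forall i, (i < n)%N -> prob (A i) <= b) ->
  prob (\big[setU/set0]_(i < n) A i) <= n%:R * b.
Proof.
move=> mA Ab; rewrite -lee_fin -probE; last first.
  by apply: bigsetU_measurable => i _; exact: mA.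
apply: le_trans (Boole_inequality P mA) _.
rewrite [leRHS](_ : _ = (\sum_(i < n) b%:E)%E).
  apply: lee_sum => i _; suff : (P (A i) <= b%:E)%E by [].
  by rewrite (probE (mA _ (ltn_ord i))) lee_fin; exact: Ab.
by rewrite sumEFin sumr_const card_ord mulr_natl.
Qed.

(** Adding the set of index [n] gains [c] and loses at most [n b] through overlaps; the total loss,
    at most [n (n - 1) / 2] times [b], is rounded up to [n^2 b]. *)
Lemma bonferroni (A : nat -> set T) n (b c : R) : 0 <= b ->
  (forall i, (i < n)%N -> measurable (A i)) ->
  (forall i, (i < n)%N -> c <= prob (A i)) ->
  (forall i j, (i < j < n)%N -> prob (A i `&` A j) <= b) ->
  n%:R * c - n%:R ^+ 2 * b <= prob (\big[setU/set0]_(i < n) A i).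
Proof.
move=> b0; elim: n => [|n IH] mA cA bA.
  by rewrite big_ord0 expr0n !mul0r subr0 prob_ge0.
have mAn i : (i < n)%N -> measurable (A i) by move=> h; apply: mA; rewrite ltnS ltnW.
have mU : measurable (\big[setU/set0]_(i < n) A i).
  by apply: bigsetU_measurable => i _; exact: mAn.
rewrite big_ord_recr/= prob_setU//; last exact: mA.
have IHn : n%:R * c - n%:R ^+ 2 * b <= prob (\big[setU/set0]_(i < n) A i).
  apply: IH => // [i ni|i j /andP[ij jn]].
    by apply: cA; rewrite ltnS ltnW.
  by apply: bA; rewrite ij ltnS ltnW.
have cn := cA _ (ltnSn n).
have inter : prob (\big[setU/set0]_(i < n) A i `&` A n) <= n%:R * b.
  rewrite big_distrl/=; apply: (@prob_bigsetU_le (fun i => A i `&` A n)) => i ni.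
    by apply: measurableI; [exact: mAn|exact: mA].
  by apply: bA; rewrite ni ltnSn.
rewrite -[n.+1%:R]natr1.
have : 0 <= n%:R :> R by [].
nra.
Qed.

End probability_real.

(** * Upper and lower bounds for the tail of a sum of i.i.d. steps *)

Section iid_bounds.
Context {d : measure_display} {T : measurableType d} {R : realType}.
Variable P : probability T R.
Variable X : nat -> T -> R.
Hypothesis HX : mutually_independent P X.
Hypothesis HX_law : forall k (B : set R), measurable B ->
  P (X k @^-1` B) = P (X 0%N @^-1` B).
Hypothesis HX1int : P.-integrable setT (EFin \o X 0%N).
Hypothesis HX1mean : (\int[P]_w (X 0%N w)%:E = 0)%E.
Hypothesis HX2int : P.-integrable setT (EFin \o (fun w => X 0%N w ^+ 2)).

Let mX k : measurable_fun setT (X k).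
Proof. exact: HX.1. Qed.

Notation s2 := (second_moment P X).
Let s2_ge0 : 0 <= s2. Proof. exact: second_moment_ge0. Qed.

Definition tail (x : R) : R := prob P [set w | x <= X 0%N w].

Lemma measurable_level k x : measurable [set w | x <= X k w].
Proof.
rewrite (_ : [set _ | _] = setT `&` X k @^-1` `[x, +oo[).
  by apply: mX => //; exact: measurable_itv.
by apply/seteqP; split=> w /=; rewrite in_itv/= andbT //; case.
Qed.

Lemma prob_level k x : prob P [set w | x <= X k w] = tail x.
Proof.
rewrite /tail /prob; congr fine.
rewrite (_ : [set w | x <= X k w] = X k @^-1` `[x, +oo[); last first.
  by apply/seteqP; split=> w /=; rewrite in_itv/= andbT.
rewrite HX_law; last exact: measurable_itv.
by congr (P _); apply/seteqP; split=> w /=; rewrite in_itv/= andbT.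
Qed.

Lemma tail_ge0 x : 0 <= tail x. Proof. exact: prob_ge0. Qed.

Lemma tail_le1 x : tail x <= 1.
Proof. by apply: prob_le1; exact: measurable_level. Qed.

Lemma ge0_expectation_prod_iid (g : R -> R) (c : R) k :
  measurable_fun setT g -> (forall x, 0 <= g x) ->
  (\int[P]_w (g (X 0%N w))%:E = c%:E)%E ->
  (\int[P]_w (\prod_(i < k) g (X i w))%:E = (c ^+ k)%:E)%E.
Proof.
move=> mg g0 gc.
have sm n : sub_measurable X [set i | (i < n)%N] (fun w => \prod_(i < n) g (X i w)).
  elim: n => [|n IH].
    rewrite (_ : (fun w => _) = cst 1); first exact: measurable_cst.
    by apply/funext => w; rewrite big_ord0.
  rewrite (_ : (fun w => _) = (fun w => (\prod_(i < n) g (X i w)) * g (X n w))).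
    apply: measurable_funM.
      by apply: sub_measurableW IH => i /= /ltnW; rewrite ltnS.
    apply: measurableT_comp => //.
    by apply: sub_measurable_proj => /=.
  by apply/funext => w; rewrite big_ord_recr.
elim: k => [|k IH].
  under eq_integral do rewrite big_ord0.
  by have := expectation_cst P 1; rewrite unlock.
under eq_integral do rewrite big_ord_recr/=.
have disj : [set i | (i < k)%N] `&` [set k] `<=` set0.
  by move=> i [/= ik ie]; move: ik; rewrite ie ltnn.
rewrite (ge0_expectation_indepM HX disj)//.
- rewrite IH (@ge0_integral_iid _ _ _ _ _ HX HX_law k (EFin \o g))//=.
  + by rewrite gc -EFinM exprSr.
  + exact/measurable_EFinP.
- apply: measurableT_comp => //.
  exact: sub_measurable_proj.
- by move=> w; apply: prodr_ge0.
Qed.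

(** Inverting [1 - u <= exp(- u)] gives [exp u <= 1 / (1 - u)], and [(1 + u + 2 u^2)(1 - u) = 1 +
    u^2 (1 - 2 u)]. *)
Lemma expR_le_quadratic (u : R) : u <= 2^-1 -> expR u <= 1 + u + 2 * u ^+ 2.
Proof.
move=> u2; have := expR_ge1Dx (- u); rewrite expRN => h.
have u1 : 0 < 1 - u by lra.
have -> : expR u = ((expR u)^-1)^-1 by rewrite invrK.
apply: (@le_trans _ _ (1 - u)^-1).
  by rewrite lef_pV2 ?posrE ?invr_gt0 ?expR_gt0//.
rewrite -[leLHS]mul1r ler_pdivrMr//.
have : 0 <= u ^+ 2 * (1 - 2 * u) by rewrite mulr_ge0 ?sqr_ge0//; lra.
by nra.
Qed.

(** The range is cut at [X = 1 / (2 h)]. Below it the quadratic bound applies and its linear term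
    integrates to zero; above it, but below [y], the exponential is at most [exp(h y)]. *)
Lemma truncated_exp_moment (h y : R) : 0 < h ->
  (\int[P]_w (expR (h * X 0%N w) * ((X 0%N w < y)%R)%:R)%:E <=
   (1 + 2 * h ^+ 2 * s2 + expR (h * y) * tail ((2 * h)^-1))%:E)%E.
Proof.
move=> h0.
pose L := [set w | (2 * h)^-1 <= X 0%N w].
have mL : measurable L by exact: measurable_level.
pose f1 w := 1 + h * X 0%N w.
pose f2 w := 2 * h ^+ 2 * X 0%N w ^+ 2 + expR (h * y) * \1_L w.
have i0 : P.-integrable setT (EFin \o cst (1 : R)).
  exact: finite_measure_integrable_cst.
have ihX : P.-integrable setT (fun w => (h * X 0%N w)%:E).
  by have := integrableZl measurableT h HX1int.
have i1 : P.-integrable setT (EFin \o f1).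
  by have := integrableD measurableT i0 ihX.
have iL : P.-integrable setT (fun w => (expR (h * y) * \1_L w)%:E).
  have mu_L : (P L < +oo)%E by rewrite probE// ltry.
  by have := integrableZl measurableT (expR (h * y))
    (integrable_indic P mL).
have iX2 : P.-integrable setT (fun w => (2 * h ^+ 2 * X 0%N w ^+ 2)%:E).
  by have := integrableZl measurableT (2 * h ^+ 2) HX2int.
have i2 : P.-integrable setT (EFin \o f2).
  by have := integrableD measurableT iX2 iL.
have le12 w : expR (h * X 0%N w) * ((X 0%N w < y)%R)%:R <= f1 w + f2 w.
  rewrite /f1 /f2; set u := h * X 0%N w.
  have q0 : 0 <= 1 + u + 2 * u ^+ 2.
    have := sqr_ge0 (u + 4^-1); nra.
  have -> : 2 * h ^+ 2 * X 0%N w ^+ 2 = 2 * u ^+ 2 by rewrite /u; ring.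
  have e0 : 0 <= expR (h * y) * \1_L w by rewrite mulr_ge0 ?expR_ge0.
  have [u2|u2] := leP u 2^-1.
    have eu := expR_le_quadratic u2.
    case: (X 0%N w < y); rewrite ?mulr1 ?mulr0; lra.
  have wL : L w.
    rewrite /L /= invfM ler_pdivrMr// mulrC.
    by apply: ltW; move: u2; rewrite /u mulrC.
  case: ltP => Xy; last by rewrite mulr0; lra.
  rewrite mulr1 indicE mem_set// mulr1.
  have : expR u <= expR (h * y) by rewrite ler_expR /u ler_pM2l// ltW.
  lra.
have m0 : measurable_fun setT (fun w => expR (h * X 0%N w) * ((X 0%N w < y)%R)%:R).
  apply: measurable_funM.
    by apply: measurableT_comp => //; exact: measurable_funM.
  rewrite (_ : (fun w => _) = \1_(~` [set w | y <= X 0%N w])).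
    by apply: measurable_indic; apply: measurableC; exact: measurable_level.
  apply/funext => w; rewrite indicE; case: ltP => h1.
    by rewrite mem_set//=; apply/negP; rewrite -ltNge.
  by rewrite memNset//= => /(_ h1).
apply: (@le_trans _ _ (\int[P]_w ((f1 w)%:E + (f2 w)%:E))%E).
  apply: ge0_le_integral => //.
  - by apply/measurable_EFinP; exact: m0.
  - by apply: emeasurable_funD; [case/integrableP : i1|case/integrableP : i2].
  - by move=> w _; rewrite -EFinD lee_fin.
rewrite integralD//.
have e1 : (\int[P]_w (h * X 0%N w)%:E = 0)%E.
  by under eq_integral do rewrite EFinM; rewrite integralZl// HX1mean mule0.
have e2 : (\int[P]_w (2 * h ^+ 2 * X 0%N w ^+ 2)%:E = (2 * h ^+ 2 * s2)%:E)%E.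
  under eq_integral do rewrite EFinM; rewrite integralZl//.
  rewrite [RHS]EFinM fineK//; exact: integrable_fin_num.
have e3 : (\int[P]_w (expR (h * y) * \1_L w)%:E =
    (expR (h * y) * tail ((2 * h)^-1))%:E)%E.
  under eq_integral do rewrite EFinM.
  rewrite integralZl//; last exact: integrable_indic.
  by rewrite integral_indic// setIT [RHS]EFinM; congr (_ * _)%E; exact: probE.
have -> : (\int[P]_w (f1 w)%:E = 1)%E.
  rewrite /f1; under eq_integral do rewrite EFinD.
  rewrite integralD//= e1 adde0.
  by have := expectation_cst P 1; rewrite unlock.
have -> : (\int[P]_w (f2 w)%:E =
    (2 * h ^+ 2 * s2 + expR (h * y) * tail ((2 * h)^-1))%:E)%E.
  rewrite /f2; under eq_integral do rewrite EFinD.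
  by rewrite integralD//= e2 e3.
by rewrite -EFinD addrA.
Qed.

Lemma measurable_psum_level k x : measurable [set w | x <= psum X k w].
Proof.
have mk := @measurable_iid_sum _ _ _ _ _ HX (iota 0 k).
have := mk measurableT _ (measurable_itv `[x, +oo[); rewrite setTI.
congr measurable; apply/seteqP; split=> w /=; rewrite in_itv/= andbT /psum;
  by rewrite -(big_mkord xpredT (fun i => X i w)) /index_iota subn0.
Qed.

(** Exponential Markov inequality. Each factor [g] carries its own truncation indicator, so the
    product over the steps remains a product of independent variables. *)
Lemma truncated_sum_bound (h x y : R) k : 0 < h ->
  prob P ([set w | forall i, (i < k)%N -> X i w < y] `&`
          [set w | x <= psum X k w]) <=
  expR (- (h * x)) *
  (1 + 2 * h ^+ 2 * s2 + expR (h * y) * tail ((2 * h)^-1)) ^+ k.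
Proof.
move=> h0; pose g u := expR (h * u) * ((u < y)%R)%:R.
have g0 u : 0 <= g u by rewrite mulr_ge0 ?expR_ge0.
have mg : measurable_fun setT g.
  apply: measurable_funM.
    by apply: measurableT_comp => //; exact: measurable_funM.
  rewrite (_ : (fun w => _) = \1_`]-oo, y[).
    by apply: measurable_indic; exact: measurable_itv.
  by apply/funext => w; rewrite indicE mem_setE in_itv.
have gle := truncated_exp_moment y h0.
set c0 := (X in (_ <= X%:E)%E) in gle.
pose c := fine (\int[P]_w (g (X 0%N w))%:E)%E.
have gc : (\int[P]_w (g (X 0%N w))%:E = c%:E)%E.
  rewrite fineK// ge0_fin_numE; last by apply: integral_ge0 => w _; rewrite lee_fin.
  by apply: le_lt_trans gle _; rewrite ltry.
have c0c : c <= c0 by rewrite -lee_fin -gc.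
have c00 : 0 <= c by apply: fine_ge0; apply: integral_ge0 => w _; rewrite lee_fin.
have mS := measurable_psum_level k x.
have mB : measurable [set w | forall i, (i < k)%N -> X i w < y].
  rewrite (_ : [set _ | _] = \bigcap_(i in [set i | (i < k)%N]) ~` [set w | y <= X i w]).
    apply: bigcap_measurableType => i _; apply: measurableC.
    exact: measurable_level.
  apply/seteqP; split=> w /= H i ik.
    by apply/negP; rewrite -ltNge; exact: H.
  by rewrite ltNge; apply/negP; exact: H.
rewrite -lee_fin -probE; last exact: measurableI.
rewrite -[X in P X]setIT -integral_indic//; last exact: measurableI.
apply: (@le_trans _ _ (\int[P]_w ((expR (- (h * x)))%:E *
    (\prod_(i < k) g (X i w))%:E))%E); last first.
  rewrite ge0_integralZl//; last 2 first.
  - apply/measurable_EFinP; apply: measurable_prod => i _.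
    exact: measurableT_comp.
  - by move=> w _; rewrite lee_fin prodr_ge0.
  rewrite (ge0_expectation_prod_iid k mg g0 gc) -EFinM lee_fin.
  rewrite ler_pM2l ?expR_gt0//; apply: lerXn2r => //.
  by rewrite nnegrE (le_trans c00).
apply: ge0_le_integral => //.
- by apply/measurable_EFinP; apply: measurable_indic; exact: measurableI.
- apply: measurable_funeM; apply/measurable_EFinP; apply: measurable_prod => i _.
  exact: measurableT_comp.
move=> w _; rewrite -EFinM lee_fin indicE.
case: (boolP (w \in _)) => [/set_mem[/= wy wx]|_]; last first.
  by rewrite mulr_ge0 ?expR_ge0 ?prodr_ge0.
rewrite (_ : \prod_(i < k) g (X i w) = expR (h * psum X k w)).
  rewrite -expRD -[leLHS]expR0 ler_expR addrC subr_ge0.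
  by rewrite ler_pM2l.
rewrite /psum mulr_sumr expR_sum; apply: eq_bigr => i _.
by rewrite /g wy// mulr1.
Qed.

Definition others (k i : nat) : seq nat := [seq j <- iota 0 k | j != i].

Lemma others_uniq k i : uniq (others k i).
Proof. by rewrite filter_uniq// iota_uniq. Qed.

Lemma size_others k i : (size (others k i) <= k)%N.
Proof. by rewrite (leq_trans (size_subseq (filter_subseq _ _)))// size_iota. Qed.

Lemma psum_others k i w : (i < k)%N ->
  psum X k w = X i w + \sum_(j <- others k i) X j w.
Proof.
move=> ik; rewrite /psum -(big_mkord xpredT (fun i => X i w)).
rewrite /index_iota subn0 (bigD1_seq i)/= ?iota_uniq ?mem_iota//.
by rewrite big_filter.
Qed.

Lemma measurable_others_level k i x :
  measurable [set w | x <= `|\sum_(j <- others k i) X j w| ].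
Proof.
have mk := @measurable_iid_sum _ _ _ _ _ HX (others k i).
have mn : measurable_fun setT (fun w => `|\sum_(j <- others k i) X j w|).
  exact: measurableT_comp.
have := mn measurableT _ (measurable_itv `[x, +oo[); rewrite setTI.
by congr measurable; apply/seteqP; split=> w /=; rewrite in_itv/= andbT.
Qed.

Lemma others_chebyshev k i y : 0 < y ->
  prob P [set w | y <= `|\sum_(j <- others k i) X j w| ] <=
  k%:R * s2 / y ^+ 2.
Proof.
move=> y0; rewrite -lee_fin -probE; last exact: measurable_others_level.
apply: le_trans (iid_sum_chebyshev HX HX_law HX1int HX1mean HX2int _ y0) _.
  exact: others_uniq.
rewrite lee_fin ler_pM2r ?invr_gt0 ?exprn_gt0// ler_wpM2r//.
by rewrite ler_nat size_others.
Qed.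

Lemma prob_level_others k i x (D : set R) : measurable D ->
  prob P ([set w | x <= X i w] `&`
          [set w | D (\sum_(j <- others k i) X j w)]) =
  tail x * prob P [set w | D (\sum_(j <- others k i) X j w)].
Proof.
move=> mD; rewrite -(prob_level i).
have disj : [set i] `&` [set` others k i] `<=` set0.
  by move=> j [/= ->]; rewrite mem_filter eqxx.
have sX : sub_measurable X [set i] (X i) by exact: sub_measurable_proj.
have sS := @sub_measurable_sum _ _ _ X (others k i).
have := sub_measurable_indep HX disj sX sS (measurable_itv `[x, +oo[) mD.
rewrite (_ : X i @^-1` _ = [set w | x <= X i w]); last first.
  by apply/seteqP; split=> w /=; rewrite in_itv/= andbT.
move=> H; apply: EFin_inj; rewrite EFinM -!probE//.
- have := (@measurable_iid_sum _ _ _ _ _ HX (others k i)) measurableT _ mD.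
  by rewrite setTI.
- exact: measurable_level.
- apply: measurableI; first exact: measurable_level.
  have := (@measurable_iid_sum _ _ _ _ _ HX (others k i)) measurableT _ mD.
  by rewrite setTI.
Qed.

Lemma measurable_norm_ge (y : R) : measurable [set z : R | y <= `|z| ].
Proof.
have mn : measurable_fun setT (fun z : R => `|z|) by exact: measurableT_comp.
have := mn measurableT _ (measurable_itv `[y, +oo[); rewrite setTI.
by congr measurable; apply/seteqP; split=> w /=; rewrite in_itv/= andbT.
Qed.

(** In the middle term the Chebyshev factor, small when [k / x^2] is small, compensates for the
    level [eta x] being lower than [x]. The parameters stay free and are tuned to [x] later. *)
Lemma psum_upper_bound k (x delta eta h : R) : 0 < x -> 0 < delta -> 0 < h ->
  prob P [set w | x <= psum X k w] <=
  k%:R * tail ((1 - delta) * x) +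
  k%:R * (tail (eta * x) * (k%:R * s2 / (delta * x) ^+ 2)) +
  expR (- (h * x)) *
  (1 + 2 * h ^+ 2 * s2 + expR (h * (eta * x)) * tail ((2 * h)^-1)) ^+ k.
Proof.
move=> x0 delta0 h0.
pose A i := [set w | (1 - delta) * x <= X i w].
pose B i := [set w | eta * x <= X i w] `&`
  [set w | delta * x <= `|\sum_(j <- others k i) X j w| ].
pose C := [set w | forall i, (i < k)%N -> X i w < eta * x] `&`
          [set w | x <= psum X k w].
have mA i : measurable (A i) by exact: measurable_level.
have mB i : measurable (B i).
  by apply: measurableI; [exact: measurable_level|exact: measurable_others_level].
have mC : measurable C.
  apply: measurableI; last exact: measurable_psum_level.
  rewrite (_ : [set _ | _] =
      \bigcap_(i in [set i | (i < k)%N]) ~` [set w | eta * x <= X i w]).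
    apply: bigcap_measurableType => i _; apply: measurableC.
    exact: measurable_level.
  apply/seteqP; split=> w /= H i ik.
    by apply/negP; rewrite -ltNge; exact: H.
  by rewrite ltNge; apply/negP; exact: H.
pose UA := \big[setU/set0]_(i < k) A i; pose UB := \big[setU/set0]_(i < k) B i.
have mUA : measurable UA by exact: bigsetU_measurable.
have mUB : measurable UB by exact: bigsetU_measurable.
have PC := truncated_sum_bound x (eta * x) k h0.
have PA : prob P UA <= k%:R * tail ((1 - delta) * x).
  by apply: prob_bigsetU_le => // i _; rewrite prob_level.
have PB : prob P UB <= k%:R * (tail (eta * x) * (k%:R * s2 / (delta * x) ^+ 2)).
  apply: prob_bigsetU_le => // i _.
  rewrite (prob_level_others k i (eta * x) (measurable_norm_ge (delta * x))).
  by rewrite ler_wpM2l ?tail_ge0// others_chebyshev// mulr_gt0.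
apply: le_trans (_ : _ <= prob P (UA `|` UB `|` C)) _.
  apply: le_prob => //; first exact: measurable_psum_level.
    by do 2?apply: measurableU.
  move=> w /= xw.
  have [allw|] := pselect (forall i, (i < k)%N -> X i w < eta * x).
    by right.
  move=> /existsNP[i /not_implyP[ik /negP]]; rewrite -leNgt => Xi.
  left; rewrite /UA /UB -!bigcup_mkord.
  have [Ai|Ai] := leP ((1 - delta) * x) (X i w); first by left; exists i.
  right; exists i => //; split => //=.
  apply: le_trans (ler_norm _); move: xw; rewrite (psum_others w ik).
  by move: Ai; nra.
apply: le_trans (prob_setU_le _ _ mC) _; first exact: measurableU.
apply: lerD PC; apply: le_trans (prob_setU_le _ mUA mUB) _.
exact: lerD.
Qed.

(** A step above [(1 + delta) x] suffices when the other steps sum to less than [delta x] in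
    absolute value. In the Bonferroni overlaps only the two large steps are kept, whence the squared
    tail. *)
Lemma psum_lower_bound k (x delta : R) : 0 < x -> 0 < delta ->
  k%:R * (tail ((1 + delta) * x) * (1 - k%:R * s2 / (delta * x) ^+ 2)) -
  k%:R ^+ 2 * tail ((1 + delta) * x) ^+ 2 <=
  prob P [set w | x <= psum X k w].
Proof.
move=> x0 delta0.
pose V i := [set w | delta * x <= `|\sum_(j <- others k i) X j w| ].
pose A i := [set w | (1 + delta) * x <= X i w] `&` ~` V i.
have mV i : measurable (V i) by exact: measurable_others_level.
have mA i : measurable (A i).
  by apply: measurableI; [exact: measurable_level|exact: measurableC].
apply: le_trans (_ : prob P (\big[setU/set0]_(i < k) A i) <= _); last first.
  apply: le_prob; [exact: bigsetU_measurable|exact: measurable_psum_level|].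
  rewrite -bigcup_mkord => w [i /= ik [Xi /= /negP]].
  rewrite -ltNge (psum_others w ik) => sx.
  have := ler_norm (- \sum_(j <- others k i) X j w); rewrite normrN.
  by move: Xi sx => /=; lra.
apply: bonferroni => //; first by rewrite exprn_ge0 ?tail_ge0.
- move=> i ik.
  rewrite (prob_level_others k i _ (measurableC (measurable_norm_ge (delta * x)))).
  rewrite ler_wpM2l ?tail_ge0//.
  have -> : [set w | (~` [set z : R | delta * x <= `|z| ])
    (\sum_(j <- others k i) X j w)] = ~` V i by [].
  by rewrite prob_setC// lerD2l lerN2 others_chebyshev// mulr_gt0.
- move=> i j /andP[ij jk].
  apply: le_trans (_ : prob P ([set w | (1 + delta) * x <= X i w] `&`
      [set w | (1 + delta) * x <= X j w]) <= _).
    apply: le_prob; [exact: measurableI| |].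
      by apply: measurableI; exact: measurable_level.
    by move=> w [[? _] [? _]].
  have disj : [set i] `&` [set j] `<=` set0.
    by move=> l [/= -> e]; move: ij; rewrite e ltnn.
  have sX l : sub_measurable X [set l] (X l) by exact: sub_measurable_proj.
  have := sub_measurable_indep HX disj (sX i) (sX j)
    (measurable_itv `[(1 + delta) * x, +oo[) (measurable_itv `[(1 + delta) * x, +oo[).
  have pre l : X l @^-1` `[(1 + delta) * x, +oo[ = [set w | (1 + delta) * x <= X l w].
    by apply/seteqP; split=> w /=; rewrite in_itv/= andbT.
  rewrite !pre => H; rewrite /prob H fineM ?fin_num_measure//;
    do ?[exact: measurable_level].
  by rewrite -!/(prob P _) !prob_level expr2.
Qed.

End iid_bounds.

(** * The one-big-jump asymptotics *)

Section powR_facts.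
Context {R : realType}.
Implicit Types x c e r : R.

Lemma powRE x c : 0 < x -> x `^ c = expR (c * ln x).
Proof. by move=> x0; rewrite /powR gt_eqF. Qed.

Lemma powR_decay c e : 0 < c -> 0 < e ->
  exists2 M : R, 0 < M & forall x : R, M <= x -> x `^ (- c) <= e.
Proof.
move=> c0 e0; exists (e `^ (- c^-1)); first exact: powR_gt0.
move=> x Mx; have x0 : 0 < x by apply: lt_le_trans Mx; exact: powR_gt0.
rewrite powRN -[e]invrK lef_pV2 ?posrE ?invr_gt0 ?powR_gt0//.
have : (e `^ (- c^-1)) `^ c <= x `^ c.
  by apply: ge0_ler_powR; rewrite ?nnegrE ?powR_ge0// ltW.
by rewrite -powRrM mulNr mulVf ?gt_eqF// powR_inv1// ltW.
Qed.

Lemma ln_le_powR r x : 0 < r -> 0 < x -> ln x <= r^-1 * x `^ r.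
Proof.
move=> r0 x0; rewrite -ler_pdivrMl ?invr_gt0// invrK -ln_powR.
have := @le_ln1Dx R (x `^ r - 1); rewrite addrCA subrr addr0 => h.
apply: le_trans (h _) _; first by rewrite ltrBDr addrC subrr powR_gt0.
by rewrite lerBlDr lerDl.
Qed.

End powR_facts.

(** * One-big-jump estimate in real variables: [t] is the step tail, [F k x] the tail of the sum of
    [k] steps *)

Section big_jump.
Context {R : realType}.
Variables (t : R -> R) (F : nat -> R -> R) (s2 theta a : R).
Hypothesis t0 : forall x : R, 0 <= t x.
Hypothesis t1 : forall x : R, t x <= 1.
Hypothesis s20 : 0 <= s2.
Hypothesis theta2 : 2 < theta.
Hypothesis a0 : 0 < a.
Hypothesis t_tail : (x `^ theta * t x) @[x --> +oo] --> a.
Hypothesis F_upper : forall k (x delta eta h : R), 0 < x -> 0 < delta -> 0 < h ->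
  F k x <= k%:R * t ((1 - delta) * x) +
    k%:R * (t (eta * x) * (k%:R * s2 / (delta * x) ^+ 2)) +
    expR (- (h * x)) *
    (1 + 2 * h ^+ 2 * s2 + expR (h * (eta * x)) * t ((2 * h)^-1)) ^+ k.
Hypothesis F_lower : forall k (x delta : R), 0 < x -> 0 < delta ->
  k%:R * (t ((1 + delta) * x) * (1 - k%:R * s2 / (delta * x) ^+ 2)) -
    k%:R ^+ 2 * t ((1 + delta) * x) ^+ 2 <= F k x.

Lemma tail_near (e : R) : 0 < e ->
  exists2 x0 : R, 0 < x0 & forall x : R, x0 <= x -> `|x `^ theta * t x - a| <= e.
Proof.
move=> e0; have /cvgrPdist_le/(_ e e0)[M [Mr HM]] := t_tail.
exists (Num.max 1 (M + 1)); first by rewrite lt_max ltr01.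
move=> x; rewrite ge_max => /andP[_ Mx]; rewrite distrC; apply: HM.
by apply: lt_le_trans Mx; rewrite ltrDl.
Qed.

(** Beyond [x0] the limit gives the constant [a + 1]; below [x0] the trivial bound [t <= 1] gives
    [x0^theta]. *)
Lemma tail_bound : exists2 C : R, 0 < C & forall x : R, 0 < x -> t x <= C * x `^ (- theta).
Proof.
have th2 := theta2; have apos := a0; have s2pos := s20.
have [x0 x00 H] := tail_near ltr01.
exists (Num.max (a + 1) (x0 `^ theta)); first by rewrite lt_max addr_gt0.
move=> x xpos; rewrite powRN -ler_pdivrMr ?invr_gt0 ?powR_gt0// invrK.
have [x0x|xx0] := leP x0 x.
  rewrite le_max mulrC; apply/orP; left; have := H x x0x.
  by rewrite ler_norml => /andP[_]; rewrite lerBlDr addrC.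
rewrite le_max; apply/orP; right.
apply: le_trans (_ : 1 * x `^ theta <= _); first by rewrite ler_wpM2r ?powR_ge0.
by rewrite mul1r; apply: ge0_ler_powR; rewrite ?nnegrE ?ltW//; lra.
Qed.

(** With [h = (theta + 1) ln x / x] this makes [exp(h eta x) = x^((theta - 2) / 2)]. Against
    [k <= x^2] and a tail of order [x^(- theta)] up to logarithms, a power [x^(- (theta - 2) / 2)]
    remains: here [theta > 2] is used. *)
Let eta := (theta - 2) / (2 * (theta + 1)).

(** For this [h], [exp(- h x) = x^(- theta - 1)], while the [k]-th power is at most [expR 1] times
    [x^(1/2)]. After multiplication by [x^theta] a factor [x^(- 1/2)] survives. *)
Lemma exponential_term (e : R) : 0 < e ->
  exists2 M : R, 0 < M & forall k (x : R), (0 < k)%N -> M <= x ->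
    M * k%:R * ln x <= x ^+ 2 ->
    let h := (theta + 1) * ln x / x in 0 < h /\
    x `^ theta * (expR (- (h * x)) *
      (1 + 2 * h ^+ 2 * s2 + expR (h * (eta * x)) * t ((2 * h)^-1)) ^+ k) <= e.
Proof.
have th2 := theta2; have apos := a0; have s2pos := s20.
move=> e0; have [C C0 tC] := tail_bound.
have th1 : 0 < theta + 1 by lra.
(* [ln x <= x^r / r] turns the factor [(ln x)^theta] into [x^((theta - 2) / 4)], half of the spare
   power; the other half, through [M1], absorbs the constant [C']. *)
pose r := (theta - 2) / (4 * theta).
have r0 : 0 < r by apply: divr_gt0; lra.
pose C' := C * (2 * (theta + 1)) `^ theta * r^-1 `^ theta.
have C'0 : 0 < C' by rewrite !mulr_gt0 ?powR_gt0 ?invr_gt0//; lra.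
have d4 : 0 < (theta - 2) / 4 by apply: divr_gt0; lra.
have C'V : 0 < C'^-1 by rewrite invr_gt0.
have [M1 M10 H1] := powR_decay d4 C'V.
have half : 0 < 2^-1 :> R by [].
have eV : 0 < e / expR 1 by rewrite divr_gt0 ?expR_gt0.
have [M2 M20 H2] := powR_decay half eV.
pose M3 := 4 * s2 * (theta + 1) ^+ 2.
exists (Num.max (Num.max (expR 1) M1) (Num.max M2 M3)).
  by rewrite !lt_max expR_gt0.
set M := Num.max _ _ => k x k0 Mx kx.
have [eM M1M M2M M3M] : [/\ expR 1 <= M, M1 <= M, M2 <= M & M3 <= M].
  by split; rewrite !le_max lexx ?orbT.
have x0 : 0 < x by apply: lt_le_trans Mx; rewrite !lt_max expR_gt0.
pose L := ln x.
have L1 : 1 <= L.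
  rewrite -[leLHS](@expRK R) ler_ln ?posrE ?expR_gt0//.
  exact: le_trans Mx.
have L0 : 0 < ln x by exact: lt_le_trans L1.
have M1' : 1 <= M.
  by apply: le_trans eM; rewrite -[leLHS]expR0 ler_expR.
have k1 : 1 <= k%:R :> R by rewrite ler1n.
have kx2 : k%:R <= x ^+ 2.
  apply: le_trans kx; rewrite -/L.
  have : 1 * k%:R * 1 <= M * k%:R * L.
    by rewrite ler_pM// ?mulr_ge0// ler_wpM2r.
  by rewrite mul1r mulr1.
move=> h; have h0 : 0 < h by rewrite divr_gt0// mulr_gt0.
split=> //.
have hx : h * x = (theta + 1) * L by rewrite /h divfK// gt_eqF.
pose z := 2 * h ^+ 2 * s2 + expR (h * (eta * x)) * t ((2 * h)^-1).
(* The variance part; [M3] is the constant for which [M3 k ln x <= x^2] gives exactly [L / 2]. *)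
have z1 : k%:R * (2 * h ^+ 2 * s2) <= L / 2.
  have -> : k%:R * (2 * h ^+ 2 * s2) =
      (4 * s2 * (theta + 1) ^+ 2) * k%:R * L / x ^+ 2 * (L / 2).
    by rewrite /h -/L; field; rewrite gt_eqF.
  rewrite -[leRHS]mul1r ler_wpM2r ?divr_ge0//; first by lra.
  rewrite ler_pdivrMr ?exprn_gt0// mul1r; apply: le_trans kx; rewrite -/L.
  by rewrite ler_wpM2r ?ler_wpM2r//; lra.
(* The large-step part; [1 / (2 h)] is of order [x / ln x], so its tail is of order
   [(ln x / x)^theta]. *)
have z2 : k%:R * (expR (h * (eta * x)) * t ((2 * h)^-1)) <= 1.
  have -> : h * (eta * x) = (theta - 2) / 2 * L.
    rewrite mulrCA hx /eta; field; lra.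
  have t2 : t ((2 * h)^-1) <= C * (2 * (theta + 1)) `^ theta * (L `^ theta * x `^ (- theta)).
    have := tC (2 * h)^-1; rewrite invr_gt0 mulr_gt0// => /(_ isT) /le_trans; apply.
    rewrite -mulrA ler_wpM2l ?(ltW C0)// le_eqVlt; apply/orP; left; apply/eqP.
    have h20 : 0 < 2 * h by rewrite mulr_gt0.
    rewrite -[(2 * h)^-1]powR_inv1 ?(ltW h20)// -powRrM mulrNN mul1r.
    have -> : 2 * h = (2 * (theta + 1)) * (L * x^-1) by rewrite /h -/L; ring.
    have xV0 : 0 <= x^-1 by rewrite invr_ge0 ltW.
    have L0' : 0 <= L by rewrite ltW.
    have th10 : 0 <= 2 * (theta + 1) by lra.
    rewrite (@powRM _ (2 * (theta + 1)))// ?mulr_ge0// (@powRM _ L)//.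
    by rewrite -[x^-1]powR_inv1 ?(ltW x0)// -powRrM mulN1r.
  have Lr : L `^ theta <= r^-1 `^ theta * x `^ ((theta - 2) / 4).
    have -> : (theta - 2) / 4 = r * theta by rewrite /r; field; lra.
    have rV0 : 0 <= r^-1 by rewrite invr_ge0 ltW.
    have L0' : 0 <= L by rewrite ltW.
    rewrite powRrM -powRM ?powR_ge0//.
    apply: ge0_ler_powR; rewrite ?nnegrE ?mulr_ge0 ?powR_ge0//; first by lra.
    exact: ln_le_powR.
  apply: le_trans (_ : x ^+ 2 * (expR ((theta - 2) / 2 * L) *
    (C * (2 * (theta + 1)) `^ theta * ((r^-1 `^ theta * x `^ ((theta - 2) / 4)) *
       x `^ (- theta)))) <= _).
    apply: ler_pM => //; first by rewrite mulr_ge0 ?expR_ge0.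
    rewrite ler_pM2l ?expR_gt0//; apply: le_trans t2 _.
    rewrite ler_wpM2l//; first by rewrite mulr_ge0 ?powR_ge0// ltW.
    by rewrite ler_wpM2r ?powR_ge0.
  rewrite (_ : _ * _ = C' * x `^ (- ((theta - 2) / 4))).
    have := H1 x (le_trans M1M Mx); rewrite -(ler_pM2l C'0) mulfV//.
    by rewrite gt_eqF.
  rewrite -powR_mulrn ?ltW// /C'.
  rewrite -/(powR _ _) !(powRE _ x0) -/L.
  rewrite (_ : expR (- ((theta - 2) / 4) * L) = expR (2 * L) *
     expR ((theta - 2) / 2 * L) * expR ((theta - 2) / 4 * L) * expR (- theta * L)).
    by ring.
  by rewrite -!expRD; congr expR; field.
have zk : (1 + 2 * h ^+ 2 * s2 + expR (h * (eta * x)) * t ((2 * h)^-1)) ^+ k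
    <= expR (L / 2 + 1).
  rewrite -addrA -/z; apply: le_trans (_ : expR z ^+ k <= _).
    apply: lerXn2r; rewrite ?nnegrE ?expR_ge0 ?expR_ge1Dx//.
    apply: addr_ge0 => //; rewrite /z; apply: addr_ge0.
      by rewrite mulr_ge0// mulr_ge0// exprn_ge0// ltW.
    by rewrite mulr_ge0// expR_ge0.
  rewrite -expRM_natl ler_expR /z mulrDr.
  exact: lerD.
apply: le_trans (_ : x `^ theta * (expR (- (h * x)) * expR (L / 2 + 1)) <= _).
  by rewrite ler_wpM2l ?powR_ge0// ler_wpM2l ?expR_ge0.
rewrite hx powRE// -/L -!expRD.
rewrite (_ : _ + _ = 1 + - 2^-1 * L); last by field.
rewrite expRD mulrC -ler_pdivlMr ?expR_gt0//.
by have := H2 x (le_trans M2M Mx); rewrite powRE.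
Qed.

Lemma big_jump_asymptotics (e : R) : 0 < e ->
  exists2 M : R, 0 < M & forall k (x : R), (0 < k)%N -> M <= x ->
    M * k%:R * ln x <= x ^+ 2 -> `|x `^ theta * F k x / k%:R - a| <= e.
Proof.
have th2 := theta2; have apos := a0; have s2pos := s20.
move=> e0; have [C C0 tC] := tail_bound.
(* The upper error is [e' (a + 3 + e')], the lower one at most [e' (2 a + 2)]; [2 a + 4] covers
   both. *)
have [e' [e'0 e'2 e'e]] :
    exists e' : R, [/\ 0 < e', e' <= 2^-1 & e' * (2 * a + 4) <= e].
  have a4 : 0 < 2 * a + 4 by lra.
  exists (Num.min 2^-1 (e / (2 * a + 4))); split.
  - by rewrite lt_min; apply/andP; split=> //; exact: divr_gt0.
  - by rewrite ge_min lexx.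
  - by rewrite -ler_pdivlMr// ge_min lexx orbT.
have th0 : 0 < theta by lra.
(* [b1] and [b2] play the roles of [1 - delta] and [1 + delta]. They are defined backwards from the
   factors [1 + e'] and [1 - e'] that rescaling [x] costs in the tail. *)
have [b1 [b10 b11 b1th]] :
    exists b1 : R, [/\ 0 < b1, b1 < 1 & b1 `^ (- theta) = 1 + e'].
  have e1 : 0 < 1 + e' by lra.
  exists ((1 + e') `^ (- theta^-1)); split; first exact: powR_gt0.
    rewrite powRE// -[ltRHS]expR0 ltr_expR nmulr_rlt0 ?oppr_lt0 ?invr_gt0//.
    by rewrite ln_gt0//; lra.
  by rewrite -powRrM mulrNN mulVf ?gt_eqF// powRr1// ltW.
have [b2 [b20 b21 b2th]] :
    exists b2 : R, [/\ 0 < b2, 1 < b2 & b2 `^ (- theta) = 1 - e'].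
  have e1 : 0 < 1 - e' by lra.
  exists ((1 - e') `^ (- theta^-1)); split; first exact: powR_gt0.
    rewrite powRE// -[ltLHS]expR0 ltr_expR nmulr_rgt0 ?oppr_lt0 ?invr_gt0//.
    by apply: ln_lt0; lra.
  by rewrite -powRrM mulrNN mulVf ?gt_eqF// powRr1// ltW.
have [x0 x00 Hx0] := tail_near e'0.
have [M1 M10 H1] := exponential_term e'0.
have eta0 : 0 < eta by apply: divr_gt0; lra.
(* Since [ln x >= 1], the hypothesis gives [k / x^2 <= 1 / M]. [K1] controls the middle term of the
   upper bound, [K2] the Chebyshev loss of the lower bound and [K3] the Bonferroni loss. *)
pose K1 := C * eta `^ (- theta) * s2 / (1 - b1) ^+ 2 / e'.
pose K2 := s2 / (b2 - 1) ^+ 2 / e'.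
pose K3 := C ^+ 2 / e'.
have [M [eM x0M M1M [K1M K2M K3M]]] : exists M : R,
    [/\ expR 1 <= M, x0 / b1 <= M, M1 <= M & [/\ K1 <= M, K2 <= M & K3 <= M]].
  exists (Num.max (Num.max (expR 1) (x0 / b1))
    (Num.max (Num.max M1 K1) (Num.max K2 K3))).
  by do !split; rewrite !le_max lexx ?orbT.
exists M; first exact: lt_le_trans (expR_gt0 1) eM.
move=> k x k0 Mx kx.
have x1 : 1 <= x.
  by apply: le_trans (le_trans eM Mx); rewrite -[leLHS]expR0 ler_expR.
have xpos : 0 < x by lra.
have L1 : 1 <= ln x.
  rewrite -[leLHS](@expRK R) ler_ln ?posrE ?expR_gt0//.
  exact: le_trans Mx.
have M0 : 0 < M by exact: lt_le_trans (expR_gt0 1) eM.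
have k1 : 1 <= k%:R :> R by rewrite ler1n.
have kM : k%:R * M <= x ^+ 2.
  apply: le_trans kx; rewrite [leRHS]mulrAC mulrC ler_wpM2r//.
  by rewrite ler_peMr// ltW.
have kMK K : 0 <= K -> K <= M -> K * (k%:R / x ^+ 2) <= 1.
  move=> K0 KM; rewrite mulrA ler_pdivrMr ?exprn_gt0// mul1r.
  by apply: le_trans kM; rewrite mulrC ler_wpM2l//; lra.
have M1kx : M1 * k%:R * ln x <= x ^+ 2.
  by apply: le_trans kx; rewrite ler_wpM2r ?ler_wpM2r//; lra.
have [h0 Hexp] := H1 k x k0 (le_trans M1M Mx) M1kx.
have xth : 0 < x `^ theta by exact: powR_gt0.
have knz : k%:R != 0 :> R by rewrite gt_eqF//; lra.
have scale (b : R) : 0 < b -> x `^ theta * t (b * x) =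
    b `^ (- theta) * ((b * x) `^ theta * t (b * x)).
  move=> b0; rewrite powRM ?ltW// powRN; field.
  by rewrite gt_eqF// powR_gt0.
have scaleC (b : R) : 0 < b -> x `^ theta * t (b * x) <= C * b `^ (- theta).
  move=> b0; rewrite scale// mulrC ler_wpM2r ?powR_ge0//.
  rewrite mulrC -ler_pdivlMr ?powR_gt0 ?mulr_gt0//.
  by have := tC (b * x); rewrite mulr_gt0// powRN; apply.
have x0b1 : x0 <= b1 * x.
  by rewrite mulrC -ler_pdivrMr//; exact: le_trans Mx.
have x0b2 : x0 <= b2 * x.
  apply: le_trans x0b1 _; rewrite ler_pM2r//; lra.
rewrite ler_norml; apply/andP; split.
  have := @F_lower k x (b2 - 1) xpos; rewrite subr_gt0 => /(_ b21).
  rewrite (addrC 1) subrK => FL.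
  pose q := x `^ theta * t (b2 * x).
  have q0 : 0 <= q by rewrite mulr_ge0// ltW.
  have qa : (1 - e') * (a - e') <= q.
    rewrite /q scale// b2th ler_wpM2l//; first by lra.
    by have := Hx0 _ x0b2; rewrite ler_norml => /andP[+ _]; lra.
  have qC : q <= C.
    apply: le_trans (scaleC _ b20) _; rewrite b2th -[leRHS]mulr1 ler_wpM2l//; lra.
  have v1 : k%:R * s2 / ((b2 - 1) * x) ^+ 2 <= e'.
    have := kMK K2 _ K2M; rewrite /K2 => H.
    rewrite -[leRHS]mulr1; apply: le_trans (ler_wpM2l (ltW e'0) (H _)).
      rewrite le_eqVlt; apply/orP; left; apply/eqP; field.
      by rewrite !gt_eqF//; lra.
    by rewrite !divr_ge0 ?exprn_ge0//; lra.
  (* [theta > 2] and [x >= 1] replace [x^(- theta)] by [x^(-2)], which reduces this term to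
     [k / x^2]. *)
  have v2 : q ^+ 2 * (k%:R * x `^ (- theta)) <= e'.
    apply: le_trans (_ : C ^+ 2 * (k%:R / x ^+ 2) <= _).
      apply: ler_pM; rewrite ?exprn_ge0 ?mulr_ge0 ?powR_ge0//.
        by apply: lerXn2r; rewrite ?nnegrE// ltW.
      rewrite ler_wpM2l// powRN lef_pV2 ?posrE ?exprn_gt0//.
      by rewrite -powR_mulrn ?(ltW xpos)//; apply: ler_powR => //; lra.
    have := kMK K3 _ K3M; rewrite /K3 => H.
    rewrite -[leRHS]mulr1; apply: le_trans (ler_wpM2l (ltW e'0) (H _)).
      rewrite le_eqVlt; apply/orP; left; apply/eqP; field.
      by rewrite !gt_eqF//; lra.
    by rewrite !divr_ge0 ?exprn_ge0//; lra.
  have FLq : q * (1 - k%:R * s2 / ((b2 - 1) * x) ^+ 2) -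
      q ^+ 2 * (k%:R * x `^ (- theta)) <= x `^ theta * F k x / k%:R.
    rewrite ler_pdivlMr; last lra.
    apply: le_trans (ler_wpM2l (ltW xth) FL).
    rewrite le_eqVlt; apply/orP; left; apply/eqP.
    rewrite powRN /q; set A := x `^ theta; set B := _ / _.
    have A0 : A != 0 by rewrite gt_eqF.
    by field.
  have qv : q * (1 - e') <= q * (1 - k%:R * s2 / ((b2 - 1) * x) ^+ 2).
    by rewrite ler_wpM2l//; lra.
  have qq : (1 - e') * (a - e') * (1 - e') <= q * (1 - e').
    by rewrite ler_wpM2r//; lra.
  have p1 : 0 <= e' ^+ 2 * (a + 2 - e') by rewrite mulr_ge0 ?sqr_ge0//; lra.
  rewrite lerBrDr; apply: le_trans FLq; apply: le_trans (lerB qv v2).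
  apply: le_trans (lerB qq (lexx _)).
  nra.
rewrite lerBlDr.
have := @F_upper k x (1 - b1) eta _ xpos _ h0; rewrite subr_gt0 => /(_ b11).
rewrite subKr => FU.
have u1 : x `^ theta * t (b1 * x) <= (1 + e') * (a + e').
  rewrite scale// b1th ler_wpM2l//; first by lra.
  by have := Hx0 _ x0b1; rewrite ler_norml => /andP[_]; lra.
have u2 : x `^ theta * t (eta * x) * (k%:R * s2 / ((1 - b1) * x) ^+ 2) <= e'.
  apply: le_trans (_ : C * eta `^ (- theta) * (k%:R * s2 / ((1 - b1) * x) ^+ 2) <= _).
    by rewrite ler_wpM2r ?scaleC// !mulr_ge0 ?invr_ge0 ?exprn_ge0// mulr_ge0//; lra.
  have := kMK K1 _ K1M; rewrite /K1 => H.
  rewrite -[leRHS]mulr1; apply: le_trans (ler_wpM2l (ltW e'0) (H _)).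
    rewrite le_eqVlt; apply/orP; left; apply/eqP; field.
    by rewrite !gt_eqF//; lra.
  by rewrite !divr_ge0 ?exprn_ge0// ?mulr_ge0 ?powR_ge0//; lra.
apply: le_trans (_ : (1 + e') * (a + e') + e' + e' <= _); last first.
  have : e' * e' <= e' * 2^-1 by rewrite ler_wpM2l// ltW.
  move: e'e; nra.
rewrite ler_pdivrMr; last lra.
apply: le_trans (ler_wpM2l (ltW xth) FU) _.
move: Hexp u2; set E := expR _ * _; set V := k%:R * s2 / _ => Hexp u2.
have -> : x `^ theta * (k%:R * t (b1 * x) + k%:R * (t (eta * x) * V) + E) =
    x `^ theta * t (b1 * x) * k%:R + x `^ theta * t (eta * x) * V * k%:R +
    x `^ theta * E by ring.
rewrite [leRHS]mulrDl; apply: lerD.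
  by rewrite mulrDl; apply: lerD; rewrite ler_wpM2r.
by apply: le_trans Hexp _; rewrite ler_peMr// ltW.
Qed.

End big_jump.

(** * Offspring generating functions *)

Section nonneg_series.
Context {R : realType}.
Implicit Types (g c : nat -> R) (l : R).

Lemma nonneg_series_cvg g c l : (forall k, 0 <= g k <= c k) ->
  (\sum_(k < n) c k) @[n --> \oo] --> l ->
  cvg ((\sum_(k < n) g k) @[n --> \oo]).
Proof.
move=> gc cl.
have nd (h : nat -> R) : (forall k, 0 <= h k) ->
    nondecreasing_seq (fun n => \sum_(k < n) h k : R).
  by move=> h0; apply/nondecreasing_seqP => n; rewrite big_ord_recr lerDl.
apply: nondecreasing_is_cvgn; first by apply: nd => k; case/andP: (gc k).
exists l => _ [n _ <-].
apply: le_trans (_ : \sum_(k < n) c k <= _).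
  by apply: ler_sum => k _; case/andP: (gc k).
have cc := cvgP _ cl; rewrite -(cvg_lim _ cl)//.
apply: nondecreasing_cvgn_le => //; apply: nd => k.
by case/andP: (gc k); exact: le_trans.
Qed.

Lemma series_le_lim g l n : (forall k, 0 <= g k) ->
  (\sum_(k < n) g k) @[n --> \oo] --> l -> \sum_(k < n) g k <= l.
Proof.
move=> g0 gl; rewrite -(cvg_lim _ gl)//.
apply: (@nondecreasing_cvgn_le _ (fun n => \sum_(k < n) g k)); last exact: cvgP gl.
by apply/nondecreasing_seqP => j; rewrite big_ord_recr lerDl.
Qed.

End nonneg_series.

(** * The offspring law: range of [beta], generating function, decay of its iterates *)

Section offspring.
Context {R : realType}.
Variables (p : nat -> R) (m : R) (mu : nat) (beta : R).
Implicit Types s t u : R.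
Hypothesis Hp0 : forall k, 0 <= p k.
Hypothesis Hpsum : (\sum_(k < n) p k) @[n --> \oo] --> (1 : R).
Hypothesis Hm : (\sum_(k < n) k%:R * p k) @[n --> \oo] --> m.
Hypothesis Hm1 : 1 < m.
Hypothesis HLlogL : cvg ((\sum_(k < n) k%:R * ln k%:R * p k) @[n --> \oo]).
Hypothesis Hbott : p 0%N = 0 /\ p 1%N = 0.
Hypothesis Hmu : 0 < p mu /\ (forall k, (k < mu)%N -> p k = 0).
Hypothesis Hbeta : mu%:R = m `^ beta.

Let m0 : 0 < m. Proof. exact: lt_trans Hm1. Qed.

Lemma mu_ge2 : (2 <= mu)%N.
Proof.
case: mu Hmu => [|[|//]] [pos _]; move: pos.
  by rewrite Hbott.1 ltxx.
by rewrite Hbott.2 ltxx.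
Qed.

(** The exponent is known only through [mu = m^beta]: [mu >= 2] makes it positive, and [mu <= m]
    will give [beta <= 1]. *)
Lemma beta_gt0 : 0 < beta.
Proof.
rewrite ltNge; apply/negP => b0.
have : mu%:R <= 1 :> R.
  by rewrite Hbeta -(powRr0 m); apply: ler_powR => //; exact: ltW.
by rewrite leNgt ltr1n; move: mu_ge2 => ->.
Qed.

Lemma mu_le_m : mu%:R <= m.
Proof.
have H : (\sum_(k < n) mu%:R * p k) @[n --> \oo] --> mu%:R * (1 : R).
  by under eq_fun do rewrite -mulr_sumr; apply: cvgMr.
rewrite -[leLHS]mulr1; apply: ler_cvg_to H Hm _.
apply: nearW => n; apply: ler_sum => k _.
have [kmu|muk] := ltnP k mu; first by rewrite Hmu.2// !mulr0.
by rewrite ler_wpM2r// ler_nat.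
Qed.

Lemma beta_le1 : beta <= 1.
Proof.
rewrite leNgt; apply/negP => b1.
have : m `^ 1 < m `^ beta.
  by rewrite !powRE// ltr_expR ltr_pM2r// ln_gt0.
by rewrite powRr1 ?(ltW m0)// -Hbeta ltNge mu_le_m.
Qed.

Definition offspring_gf (s : R) : R := limn (fun n => \sum_(k < n) s ^+ k * p k).
Local Notation f := offspring_gf.

Lemma offspring_gf_cvg s : 0 <= s <= 1 ->
  (\sum_(k < n) s ^+ k * p k) @[n --> \oo] --> f s.
Proof.
move=> /andP[s0 s1].
apply: (@nonneg_series_cvg _ (fun k => s ^+ k * p k) p 1) => // k.
by rewrite mulr_ge0 ?exprn_ge0//= -[leRHS]mul1r ler_wpM2r// exprn_ile1.
Qed.

Lemma offspring_gf_le s t : 0 <= s -> s <= t -> t <= 1 -> f s <= f t.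
Proof.
move=> s0 st t1.
have cs := @offspring_gf_cvg s; have ct := @offspring_gf_cvg t.
apply: ler_cvg_to (cs _) (ct _) _.
- by rewrite s0 (le_trans st).
- by rewrite t1 (le_trans s0).
apply: nearW => n; apply: ler_sum => k _.
by rewrite ler_wpM2r//; apply: lerXn2r; rewrite ?nnegrE// (le_trans s0).
Qed.

Lemma offspring_gf_ge0 s : 0 <= s <= 1 -> 0 <= f s.
Proof.
move=> s01; apply: le_trans (@series_le_lim _ (fun k => s ^+ k * p k) _ 0%N _
  (offspring_gf_cvg s01)).
  by rewrite big_ord0.
by move=> k; rewrite mulr_ge0// exprn_ge0//; case/andP: s01.
Qed.

Lemma offspring_gf_le_pow s : 0 <= s <= 1 -> f s <= s ^+ mu.
Proof.
move=> s01; have /andP[s0 s1] := s01.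
have H : (\sum_(k < n) s ^+ mu * p k) @[n --> \oo] --> s ^+ mu * (1 : R).
  by under eq_fun do rewrite -mulr_sumr; apply: cvgMr.
rewrite -[leRHS]mulr1; apply: ler_cvg_to (offspring_gf_cvg s01) H _.
apply: nearW => n; apply: ler_sum => k _.
have [kmu|muk] := ltnP k mu; first by rewrite Hmu.2// !mulr0.
by rewrite ler_wpM2r//; apply: ler_wiXn2l.
Qed.

Lemma offspring_gf_le1 s : 0 <= s <= 1 -> f s <= 1.
Proof.
move=> s01; apply: ler_cvg_to (offspring_gf_cvg s01) Hpsum _.
apply: nearW => n; apply: ler_sum => k _; case/andP: s01 => s0 s1.
by rewrite -[leRHS]mul1r ler_wpM2r// exprn_ile1.
Qed.

Lemma onem_gf_cvg s : 0 <= s <= 1 ->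
  (\sum_(k < n) (1 - s ^+ k) * p k) @[n --> \oo] --> 1 - f s.
Proof.
move=> s01.
rewrite [X in X @ _ --> _](_ : _ =
    (fun n => \sum_(k < n) p k - \sum_(k < n) s ^+ k * p k)).
  by apply: cvgB => //; exact: offspring_gf_cvg.
by apply/funext => n; rewrite -sumrB; apply: eq_bigr => k _; rewrite mulrBl mul1r.
Qed.

Lemma exprn_ge_onem (s : R) k : 0 <= s <= 1 -> 1 - k%:R * (1 - s) <= s ^+ k.
Proof.
move=> /andP[s0 s1]; elim: k => [|k IH]; first by rewrite mul0r subr0 expr0.
rewrite exprS -natr1.
have : s * (1 - k%:R * (1 - s)) <= s * s ^+ k by rewrite ler_wpM2l.
have : 0 <= k%:R * (1 - s) ^+ 2 :> R by rewrite mulr_ge0 ?sqr_ge0.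
nra.
Qed.

Lemma onem_gf_le s : 0 <= s <= 1 -> 1 - f s <= m * (1 - s).
Proof.
move=> s01; have H : (\sum_(k < n) k%:R * p k * (1 - s)) @[n --> \oo] --> m * (1 - s).
  by under eq_fun do rewrite -mulr_suml; apply: cvgMl.
apply: ler_cvg_to (onem_gf_cvg s01) H _; apply: nearW => n; apply: ler_sum => k _.
rewrite mulrAC ler_wpM2r//; have := exprn_ge_onem k s01; lra.
Qed.

(** With [xi] of the offspring law, this is [E(xi min(1, t xi))]. It bounds the gap between [m] and
    the chord slope [(1 - f(1 - t)) / t], and its form makes sums over [t = m^(-j)] explicit. *)
Definition gf_defect (t : R) : R :=
  limn (fun n => \sum_(k < n) k%:R * Num.min 1 (k%:R * t) * p k).
Local Notation A := gf_defect.

Lemma gf_defect_cvg t : 0 <= t ->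
  (\sum_(k < n) k%:R * Num.min 1 (k%:R * t) * p k) @[n --> \oo] --> A t.
Proof.
move=> t0.
apply: (@nonneg_series_cvg _ (fun k => k%:R * Num.min 1 (k%:R * t) * p k)
  (fun k => k%:R * p k) m) => // k.
have min0 : 0 <= Num.min 1 (k%:R * t) by rewrite le_min ler01 mulr_ge0.
rewrite !mulr_ge0//= ler_wpM2r// -[leRHS]mulr1 ler_wpM2l//.
by rewrite ge_min lexx.
Qed.

Lemma gf_defect_le t u : 0 <= t -> t <= u -> A t <= A u.
Proof.
move=> t0 tu; apply: ler_cvg_to (gf_defect_cvg t0) (gf_defect_cvg _) _.
  exact: le_trans tu.
apply: nearW => n; apply: ler_sum => k _; rewrite ler_wpM2r// ler_wpM2l//.
by rewrite le_min ge_min lexx/= ge_min ler_wpM2l// orbT.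
Qed.

Lemma gf_defect_ge0 t : 0 <= t -> 0 <= A t.
Proof.
move=> t0; apply: le_trans (@series_le_lim _
  (fun k => k%:R * Num.min 1 (k%:R * t) * p k) _ 0%N _ (gf_defect_cvg t0)).
  by rewrite big_ord0.
by move=> k; rewrite !mulr_ge0// le_min ler01 mulr_ge0.
Qed.

Lemma exprn_le_quadratic (s : R) k : 0 <= s <= 1 ->
  s ^+ k <= 1 - k%:R * (1 - s) + k%:R ^+ 2 * (1 - s) ^+ 2.
Proof.
move=> /andP[s0 s1]; elim: k => [|k IH].
  by rewrite expr0 expr0n mul0r mul0r subr0 addr0.
rewrite exprS -natr1.
have : s * s ^+ k <= s * (1 - k%:R * (1 - s) + k%:R ^+ 2 * (1 - s) ^+ 2).
  by rewrite ler_wpM2l.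
have : 0 <= (1 - s) ^+ 2 * (k%:R + 1) by rewrite mulr_ge0 ?sqr_ge0.
have : 0 <= k%:R ^+ 2 * (1 - s) ^+ 3 by rewrite mulr_ge0 ?sqr_ge0 ?exprn_ge0 ?subr_ge0.
nra.
Qed.

(** Termwise: if [k (1 - s) >= 1] the left term vanishes; otherwise the second-order bound on [s^k]
    applies. *)
Lemma onem_gf_ge s : 0 <= s <= 1 -> (1 - s) * (m - A (1 - s)) <= 1 - f s.
Proof.
move=> s01; have /andP[s0 s1] := s01.
have t0 : 0 <= 1 - s by rewrite subr_ge0.
have H : (\sum_(k < n) (1 - s) * (k%:R * p k - k%:R * Num.min 1 (k%:R * (1 - s)) * p k))
    @[n --> \oo] --> (1 - s) * (m - A (1 - s)).
  under eq_fun do rewrite -mulr_sumr sumrB.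
  by apply: cvgMr; apply: cvgB => //; exact: gf_defect_cvg.
apply: ler_cvg_to H (onem_gf_cvg s01) _; apply: nearW => n; apply: ler_sum => k _.
rewrite -mulrBl mulrA ler_wpM2r//.
case: (leP 1 (k%:R * (1 - s))) => h.
  by rewrite mulr1 subrr mulr0 subr_ge0 exprn_ile1.
have := exprn_le_quadratic k s01; nra.
Qed.

Lemma sum_min_geometric (y : R) J : 0 <= y ->
  \sum_(j < J) Num.min 1 (y / m ^+ j) <= y * (m / (m - 1)).
Proof.
have m1 := Hm1; have mp := m0.
elim: J y => [|J IH] y y0.
  by rewrite big_ord0 !mulr_ge0 ?invr_ge0//; lra.
rewrite big_ord_recl expr0 divr1.
under eq_bigr do rewrite /bump /= exprS invfM mulrA.
have min1 : Num.min 1 y <= y by rewrite ge_min lexx orbT.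
apply: le_trans (lerD min1 (IH (y / m) _)) _.
  by rewrite divr_ge0// ltW.
rewrite le_eqVlt; apply/orP; left; apply/eqP; field.
by rewrite gt_eqF//=; lra.
Qed.

(** About [ln y / ln m] terms equal 1 and the others form a geometric tail. With [y = k] this
    logarithm is what the L log L condition pays for. *)
Lemma sum_min_log (y : R) J : 1 <= y ->
  \sum_(j < J) Num.min 1 (y / m ^+ j) <= ln y / ln m + (1 + m / (m - 1)).
Proof.
have m1 := Hm1; have mp := m0.
have lm : 0 < ln m by exact: ln_gt0.
have c0 : 0 <= m / (m - 1) by rewrite divr_ge0//; lra.
elim: J y => [|J IH] y y1.
  by rewrite big_ord0 !addr_ge0// divr_ge0 ?ln_ge0// ltW.
rewrite big_ord_recl expr0 divr1.
under eq_bigr do rewrite /bump /= exprS invfM mulrA.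
have min1 : Num.min 1 y <= 1 by rewrite ge_min lexx.
have [my|ym] := leP m y.
  apply: le_trans (lerD min1 (IH (y / m) _)) _; first by rewrite ler_pdivlMr// mul1r.
  rewrite ln_div ?posrE//; last lra.
  rewrite le_eqVlt; apply/orP; left; apply/eqP; field.
  by rewrite !gt_eqF//=; lra.
apply: le_trans (lerD min1 (@sum_min_geometric (y / m) J _)) _.
  by rewrite divr_ge0//; lra.
have : y / m * (m / (m - 1)) <= m / (m - 1).
  by rewrite -[leRHS]mul1r ler_wpM2r// ler_pdivrMr// mul1r ltW.
have : 0 <= ln y / ln m by rewrite divr_ge0 ?ln_ge0// ltW.
lra.
Qed.

Lemma gf_defect_summable : exists C : R, forall J,
  \sum_(j < J) A (m ^+ j)^-1 <= C.
Proof.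
have m1 := Hm1; have mp := m0.
have lm : 0 < ln m by exact: ln_gt0.
pose c := 1 + m / (m - 1).
have /cvg_ex[/= l Hl] := HLlogL.
exists (l / ln m + m * c) => J.
have H1 : (\sum_(j < J) \sum_(k < n) k%:R * Num.min 1 (k%:R * (m ^+ j)^-1) * p k)
    @[n --> \oo] --> \sum_(j < J) A (m ^+ j)^-1.
  elim: J => [|J IH].
    by under eq_fun do rewrite big_ord0; rewrite big_ord0; exact: cvg_cst.
  under eq_fun do rewrite big_ord_recr; rewrite big_ord_recr/=.
  apply: cvgD => //; apply: gf_defect_cvg.
  by rewrite invr_ge0 exprn_ge0// ltW.
have H2 : (\sum_(k < n) k%:R * ln k%:R * p k / ln m + \sum_(k < n) k%:R * p k * c)
    @[n --> \oo] --> l / ln m + m * c.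
  under eq_fun do rewrite -!mulr_suml.
  by apply: cvgD; apply: cvgMl.
apply: ler_cvg_to H1 H2 _; apply: nearW => n.
rewrite exchange_big/= -big_split/=; apply: ler_sum => k _.
rewrite -mulr_suml -mulr_sumr.
have -> : k%:R * ln k%:R * p k / ln m + k%:R * p k * c =
    k%:R * (ln k%:R / ln m + c) * p k by ring.
rewrite ler_wpM2r//; case: (nat_of_ord k) => [|k']; first by rewrite !mul0r.
by rewrite ler_wpM2l// sum_min_log// ler1n.
Qed.

Lemma iter_gf_in01 s n : 0 <= s <= 1 -> 0 <= iter n f s <= 1.
Proof.
by move=> s01; elim: n => //= n IH; rewrite offspring_gf_ge0//= offspring_gf_le1.
Qed.

Lemma iter_gf_le s t n : 0 <= s -> s <= t -> t <= 1 -> iter n f s <= iter n f t.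
Proof.
move=> s0 st t1; have s1 : 0 <= s <= 1 by rewrite s0 (le_trans st).
have t01 : 0 <= t <= 1 by rewrite t1 (le_trans s0).
elim: n => //= n IH; apply: offspring_gf_le => //.
  by case/andP: (iter_gf_in01 n s1).
by case/andP: (iter_gf_in01 n t01).
Qed.

Lemma iter_gf_le_pow s n : 0 <= s <= 1 -> iter n f s <= s ^+ (mu ^ n).
Proof.
move=> s01; elim: n => [|n IH]; first by rewrite expn0 expr1.
have /andP[i0 i1] := iter_gf_in01 n s01.
rewrite iterS; apply: le_trans (offspring_gf_le_pow _) _; first by rewrite i0.
rewrite expnS mulnC exprM; apply: lerXn2r => //; rewrite nnegrE//.
by apply: exprn_ge0; case/andP: s01.
Qed.

(* The Kesten-Stigum condition keeps the Laplace transforms of [Z_n / m^n]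
   uniformly away from 1: the losses in [1 - f(s) >= (1 - s)(m - A(1 - s))]
   along the iteration are summable. *)
Lemma iter_gf_bounded_away : exists2 h : R, 0 < h <= 1 &
  forall n, iter n f (expR (- (h / m ^+ n))) <= 1 - h / 4.
Proof.
have m1 := Hm1; have mp := m0.
have mX n : 0 < m ^+ n by exact: exprn_gt0.
pose a j := A (m ^+ j)^-1.
have a0 j : 0 <= a j by apply: gf_defect_ge0; rewrite invr_ge0 ltW.
have [C HC] := gf_defect_summable.
pose S J := \sum_(j < J) a j.
have Srec k : S k.+1 = S k + a k by rewrite /S big_ord_recr.
have Snd : nondecreasing_seq S.
  by apply/nondecreasing_seqP => j; rewrite /S big_ord_recr lerDl.
have Scvg : cvgn S.
  by apply: nondecreasing_is_cvgn => //; exists C => _ [n _ <-]; exact: HC.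
have m4 : 0 < m / 4 by rewrite divr_gt0.
have /cvgrPdist_le/(_ _ m4)[J0 _ HJ0] := Scvg.
(* From index [J] on the losses sum to at most [m / 4]; the witness [h = m^(-J)] makes the iteration
   use only these. *)
pose J := J0.+1.
have HJ n : \sum_(j < n) a (J + j)%N <= m / 4.
  have -> : \sum_(j < n) a (J + j)%N = S (J + n)%N - S J.
    elim: n => [|n IH]; first by rewrite big_ord0 addn0 subrr.
    by rewrite big_ord_recr/= IH addnS Srec; ring.
  have le1 : S (J + n)%N <= limn S by exact: nondecreasing_cvgn_le.
  have := HJ0 J (leqnSn J0); rewrite /= ler_norml => /andP[_]; lra.
exists (m ^+ J)^-1 => [|n].
  rewrite invr_gt0 mX/= invf_le1//.
  by apply: exprn_ege1; exact: ltW.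
set h := (m ^+ J)^-1.
have h0 : 0 < h by rewrite invr_gt0.
have h1 : h <= 1 by rewrite invf_le1// exprn_ege1// ltW.
set s := expR _.
have hn0 : 0 <= h / m ^+ n by rewrite divr_ge0// ltW.
have s01 : 0 <= s <= 1.
  by rewrite expR_ge0/= -[leRHS]expR0 ler_expR oppr_le0.
(* [tt i] is at most [h m^(i - n) = m^(- (J + n - i))], so the loss at step [i] is at most
   [a (J + (n - i))]: the indices run down from [J + n]. *)
pose tt i := 1 - iter i f s.
have tt0 i : 0 <= tt i by rewrite subr_ge0; case/andP: (iter_gf_in01 i s01).
have tup i : tt i <= h / m ^+ n * m ^+ i.
  elim: i => [|i IH].
    rewrite expr0 mulr1 /tt /= /s; have := expR_ge1Dx (- (h / m ^+ n)); lra.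
  rewrite /tt iterS; apply: le_trans (onem_gf_le (iter_gf_in01 i s01)) _.
  by rewrite -/(tt i) exprS mulrCA ler_wpM2l// ltW.
(* The product of the factors [1 - a / m] is bounded below by 1 minus their sum; the bound [m / 4]
   on that sum keeps [m - ai] nonnegative in the induction. *)
have tlow i : (i <= n)%N ->
    tt 0%N * m ^+ i * (1 - (\sum_(l < i) a (J + (n - l))%N) / m) <= tt i /\
    \sum_(l < i) a (J + (n - l))%N <= m / 4.
  move=> lein.
  have sumle j : (j <= n)%N -> \sum_(l < j) a (J + (n - l))%N <= m / 4.
    move=> jn; apply: le_trans (HJ n.+1).
    rewrite [leRHS](reindex_inj rev_ord_inj)/=.
    under [leRHS]eq_bigr do rewrite subSS.
    have nd : nondecreasing_seq (fun k => \sum_(l < k) a (J + (n - l))%N).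
      by apply/nondecreasing_seqP => k; rewrite big_ord_recr lerDl.
    by apply: nd; exact: leqW.
  split; last exact: sumle.
  elim: i lein => [|i IH] lein; first by rewrite big_ord0 mul0r subr0 expr0 !mulr1.
  have {}IH := IH (ltnW lein).
  have ti : tt i <= (m ^+ (J + (n - i)))^-1.
    apply: le_trans (tup i) _.
    rewrite exprD exprB ?unitfE ?gt_eqF//; last exact: ltnW.
    by rewrite /h !invfM invrK mulrA.
  have := onem_gf_ge (iter_gf_in01 i s01); rewrite -/(tt i) -iterS -/(tt i.+1).
  apply: le_trans.
  have Ai : A (tt i) <= a (J + (n - i))%N by apply: gf_defect_le.
  have s1 := sumle _ lein; have s2 := sumle _ (ltnW lein).
  move: s1 IH; rewrite big_ord_recr/= => s1 IH.
  set si := \sum_(l < i) _ in s1 s2 IH *; set ai := a _ in s1 Ai *.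
  have si0 : 0 <= si by apply: sumr_ge0.
  have ai0 : 0 <= ai by exact: a0.
  apply: le_trans (_ : tt i * (m - ai) <= _); last first.
    by rewrite ler_wpM2l// lerD2l lerN2.
  apply: le_trans (_ : tt 0%N * m ^+ i * (1 - si / m) * (m - ai) <= _); last first.
    by rewrite ler_wpM2r//; lra.
  rewrite exprS.
  have -> : tt 0%N * (m * m ^+ i) * (1 - (si + ai) / m) =
      tt 0%N * m ^+ i * (m - si - ai) by field; rewrite gt_eqF.
  rewrite -[leRHS]mulrA ler_wpM2l ?mulr_ge0// ?(ltW (mX _))//.
  have -> : (1 - si / m) * (m - ai) = m - si - ai + si * ai / m.
    by field; rewrite gt_eqF.
  by rewrite lerDl !mulr_ge0// invr_ge0 ltW.
have [low sle] := tlow n (leqnn n).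
(* This is [1 - exp(- y) >= y / 2] on [[0, 1]]; with the factor [3 / 4] left by the losses, the
   result is [3 h / 8]. *)
have t0low : h / m ^+ n / 2 <= tt 0%N.
  rewrite /tt /= /s; set y := h / m ^+ n.
  have y1 : y <= 1.
    rewrite ler_pdivrMr// mul1r; apply: le_trans h1 _.
    by apply: exprn_ege1; exact: ltW.
  have y0 : 0 <= y by exact: hn0.
  have := expR_ge1Dx y; rewrite expRN => e1.
  have : (expR y)^-1 <= (1 + y)^-1 by rewrite lef_pV2 ?posrE ?expR_gt0//; lra.
  have : (1 + y)^-1 <= 1 - y / 2.
    rewrite -[leLHS]mul1r ler_pdivrMr; last lra.
    have : 0 <= y * (1 - y) by rewrite mulr_ge0//; lra.
    nra.
  lra.
suff : h / 4 <= tt n by rewrite /tt; lra.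
apply: le_trans low.
apply: le_trans (_ : h / m ^+ n / 2 * m ^+ n * (3 / 4) <= _).
  have -> : h / m ^+ n / 2 * m ^+ n * (3 / 4) = h * (3 / 8).
    by field; rewrite gt_eqF.
  by rewrite ler_wpM2l ?(ltW h0)//; lra.
apply: ler_pM.
- by apply: mulr_ge0; [exact: divr_ge0|exact: ltW].
- exact: divr_ge0.
- by rewrite ler_wpM2r// ltW.
have : (\sum_(l < n) a (J + (n - l))%N) / m <= 4^-1.
  by rewrite ler_pdivrMr// mulrC.
lra.
Qed.

(** Let [m^j h <= x < m^(j + 1) h]. The inner [n - j] iterates bring the value below [1 - h / 4],
    and the outer [j] raise it to the power [mu^j = (m^j)^beta], which exceeds
    [(x / (m h))^beta]. *)
Lemma iter_gf_decay : exists h c : R, [/\ 0 < h, 0 < c &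
  forall n (x : R), h <= x -> iter n f (expR (- (x / m ^+ n))) <= expR (- (c * x `^ beta))].
Proof.
have m1 := Hm1; have mp := m0; have b0 := beta_gt0.
have mX n : 0 < m ^+ n by exact: exprn_gt0.
have lm : 0 < ln m by exact: ln_gt0.
have [h /andP[h0 h1] Hh] := iter_gf_bounded_away.
have mh : 0 < m * h by exact: mulr_gt0.
exists h, (h / 4 * (m * h) `^ (- beta)); split => //.
  by rewrite mulr_gt0 ?divr_gt0 ?powR_gt0.
move=> n x hx; have x0 : 0 < x by exact: lt_le_trans hx.
have [j jle jgt] : exists2 j : nat, m ^+ j * h <= x & x < m ^+ j.+1 * h.
  have xh1 : 1 <= x / h by rewrite ler_pdivlMr// mul1r.
  have y0 : 0 <= ln (x / h) / ln m by rewrite divr_ge0 ?ln_ge0// ltW.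
  have /andP[t1 t2] := truncn_itv y0.
  set j := Num.truncn _ in t1 t2; exists j.
    rewrite -ler_pdivlMr// -ler_ln ?posrE// ?divr_gt0// lnXn//.
    by rewrite -[leLHS]mulr_natl -ler_pdivlMr.
  rewrite -ltr_pdivrMr// -ltr_ln ?posrE ?divr_gt0// lnXn//.
  by rewrite -[ltRHS]mulr_natl -ltr_pdivrMr.
have main : iter n f (expR (- (x / m ^+ n))) <= expR (- (h / 4 * mu%:R ^+ j)).
  have in01 (y : R) : 0 <= y -> 0 <= expR (- y) <= 1.
    by move=> y0; rewrite expR_ge0/= -[leRHS]expR0 ler_expR oppr_le0.
  have xn0 : 0 <= x / m ^+ n by rewrite divr_ge0// ltW.
  have [jn|nj] := leqP j n.
    apply: le_trans (_ : iter n f (expR (- (h / m ^+ (n - j)))) <= _).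
      apply: iter_gf_le; rewrite ?expR_ge0 ?ler_expR ?lerN2//; last first.
        by rewrite -[leRHS]expR0 ler_expR oppr_le0 divr_ge0// ltW.
      rewrite ler_pdivlMr// exprB ?unitfE ?gt_eqF//.
      have -> : h / (m ^+ n / m ^+ j) * m ^+ n = m ^+ j * h.
        by field; rewrite !gt_eqF.
      exact: jle.
    rewrite -{1}(subnKC jn) iterD.
    have /andP[i0 i1] := iter_gf_in01 (n - j) (in01 (h / m ^+ (n - j)) (divr_ge0 (ltW h0) (ltW (mX _)))).
    apply: le_trans (iter_gf_le_pow j _) _; first by rewrite i0.
    have -> : - (h / 4 * mu%:R ^+ j) = (mu ^ j)%:R * - (h / 4).
      by rewrite natrX; ring.
    rewrite expRM_natl.
    apply: lerXn2r; rewrite ?nnegrE ?expR_ge0//.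
    by apply: le_trans (Hh _) _; exact: expR_ge1Dx.
  (* Here [n < j], so only [n] powers of [mu] are available; the missing ones come from
     [x / m^n >= h m^(j - n) >= h mu^(j - n)]. *)
  apply: le_trans (iter_gf_le_pow n (in01 _ xn0)) _.
  rewrite -expRM_natl ler_expR mulrN lerN2 natrX.
  have jE : j = ((j - n) + n)%N by rewrite subnK// ltnW.
  apply: le_trans (_ : h * mu%:R ^+ j <= _).
    by rewrite ler_wpM2r ?exprn_ge0//; lra.
  rewrite {1}jE exprD mulrA [leRHS]mulrC ler_wpM2r ?exprn_ge0//.
  rewrite ler_pdivlMr// (le_trans _ jle)// {2}jE exprD mulrC mulrA.
  rewrite -[leRHS]mulrA [leLHS]mulrC.
  rewrite ler_wpM2r ?mulr_ge0 ?(ltW h0) ?(ltW (mX n))//.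
  by apply: lerXn2r; rewrite ?nnegrE ?(ltW mp)// mu_le_m.
apply: le_trans main _; rewrite ler_expR lerN2 -mulrA ler_wpM2l ?divr_ge0 ?(ltW h0)//.
have -> : mu%:R ^+ j = (m ^+ j) `^ beta.
  by rewrite Hbeta -!powR_mulrn ?powR_ge0 ?(ltW mp)// powRAC.
rewrite powRN mulrC ler_pdivrMr ?powR_gt0// -powRM ?(ltW (mX j)) ?(ltW mh)//.
apply: ge0_ler_powR; rewrite ?nnegrE ?(ltW b0) ?(ltW x0)//.
  by rewrite mulr_ge0 ?(ltW mh) ?(ltW (mX j)).
by rewrite mulrA -exprSr ltW.
Qed.

End offspring.

(** * Galton-Watson processes *)

Section nat_valued.
Context {d : measure_display} {T : measurableType d} {R : realType}.

Lemma measurable_fun_natr (N : T -> nat) :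
  measurable_fun setT (fun w => (N w)%:R : R) -> measurable_fun setT N.
Proof.
move=> mN _ B _; rewrite setTI.
have -> : N @^-1` B = \bigcup_(k in B) ((fun w => (N w)%:R : R) @^-1` [set k%:R]).
  apply/seteqP; split=> [w Bw|w [k Bk /= /eqP]]; first by exists (N w).
  by rewrite eqr_nat => /eqP ->.
apply: bigcup_measurable => k _.
by rewrite -[X in measurable X]setTI; apply: mN.
Qed.

End nat_valued.

Section galton_watson.
Context {d : measure_display} {T : measurableType d} {R : realType}.
Variable P : probability T R.
Variables (p : nat -> R) (xi : nat -> nat -> T -> nat) (X : nat -> T -> R).

Definition GW_family (i : ((nat * nat) + nat)%type) (w : T) : R :=
  match i with
  | inl (n, j) => (xi n j w)%:R
  | inr k => X k w
  end.

Hypothesis HY : mutually_independent P GW_family.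
Hypothesis Hp0 : forall k, 0 <= p k.
Hypothesis Hpsum : (\sum_(k < n) p k) @[n --> \oo] --> (1 : R).
Hypothesis Hxi_law : forall n i k, P [set w | xi n i w = k] = (p k)%:E.

(** [Z_n] depends on this block, the next generation's births on [generation n] and the walk on
    [steps]. The blocks are disjoint, hence independent. *)
Definition generations_before (n : nat) : set ((nat * nat) + nat)%type :=
  [set i | if i is inl (j, _) then (j < n)%N else false].
Definition generation (n : nat) : set ((nat * nat) + nat)%type :=
  [set i | if i is inl (j, _) then j = n else False].
Definition steps : set ((nat * nat) + nat)%type :=
  [set i | if i is inr _ then True else False].

Lemma sub_measurable_xi (A : set ((nat * nat) + nat)%type) n j :
  A (inl (n, j)) -> sub_measurable GW_family A (xi n j).
Proof.
move=> Anj.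
apply: (@measurable_fun_natr _ (g_sigma_algebraType (cylinders GW_family A)) R).
have H : sub_measurable GW_family A (GW_family (inl (n, j))).
  exact: sub_measurable_proj.
exact H.
Qed.

(** The number of summands is random, so the event is split according to the value of the previous
    generation. *)
Lemma sub_measurable_GW_Z n :
  sub_measurable GW_family (generations_before n) (GW_Z xi n).
Proof.
elim: n => [|n IH]; first exact: measurable_cst.
pose TA := g_sigma_algebraType (cylinders GW_family (generations_before n.+1)).
have IH' : @measurable_fun _ _ TA _ setT (GW_Z xi n).
  by apply: sub_measurableW IH => -[[j l]|//] /= /ltnW; rewrite ltnS.
move=> _ B _; rewrite setTI.
have -> : GW_Z xi n.+1 @^-1` B = \bigcup_k (GW_Z xi n @^-1` [set k] `&`
    (fun w => (\sum_(i < k) xi n i w)%N) @^-1` B).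
  apply/seteqP; split=> [w Bw|w [k _ [/= Zk]]]; first by exists (GW_Z xi n w).
  by rewrite -Zk.
apply: bigcup_measurable => k _; apply: measurableI.
  by have := IH' measurableT [set k]; rewrite setTI; apply.
have mk : @measurable_fun _ _ TA _ setT (fun w => (\sum_(i < k) xi n i w)%N).
  apply: (@measurable_fun_natr _ TA R).
  rewrite (_ : (fun w => _) = (fun w => \sum_(i < k) (xi n i w)%:R)); last first.
    by apply/funext => w; rewrite natr_sum.
  apply: measurable_sum => i.
  have H : sub_measurable GW_family (generations_before n.+1)
      (GW_family (inl (n, i : nat))).
    by apply: sub_measurable_proj => /=.
  exact H.
by have := mk measurableT B; rewrite setTI; apply.
Qed.

Lemma measurable_GW_Z n : measurable_fun setT (GW_Z xi n).
Proof. exact: (sub_measurable_fun HY (@sub_measurable_GW_Z n)). Qed.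

Lemma measurable_GW_Z_natr n : measurable_fun setT (fun w => (GW_Z xi n w)%:R : R).
Proof. by apply: (measurableT_comp _ (@measurable_GW_Z n)). Qed.

Lemma ge0_integral_xi n i (g : nat -> R) (l : R) : (forall k, 0 <= g k) ->
  (\sum_(k < N) g k * p k) @[N --> \oo] --> l ->
  (\int[P]_w (g (xi n i w))%:E = l%:E)%E.
Proof.
move=> g0 gl.
have mxi : measurable_fun setT (xi n i).
  exact: (sub_measurable_fun HY (@sub_measurable_xi setT n i I)).
rewrite (@ge0_integral_nat_partition _ _ _ P (xi n i) (fun k _ => (g k)%:E))//;
  last by move=> k _; rewrite lee_fin.
under eq_eseriesr.
  move=> k _; rewrite ge0_integralZr//; last 2 first.
  - apply/measurable_EFinP; apply: measurable_indic.
    by rewrite -[X in measurable X]setTI; apply: mxi.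
  - by rewrite lee_fin.
  rewrite integral_indic//; last by rewrite -[X in measurable X]setTI; apply: mxi.
  rewrite setIT.
  rewrite [X in (X * _)%E](_ : _ = (p k)%:E); last exact: Hxi_law.
  rewrite -EFinM mulrC; over.
apply/cvg_lim => //.
rewrite (_ : (fun N => _) = EFin \o (fun N => \sum_(k < N) g k * p k)).
  by apply/fine_cvgP; split; [exact: nearW|exact: gl].
by apply/funext => N; rewrite /= sumEFin big_mkord.
Qed.

Local Notation f := (offspring_gf p).

(** Averaging over the last generation replaces [s^(Z_(n+1))] by [f(s)^(Z_n)]. The argument changes,
    so the induction is uniform in [s]. *)
Lemma GW_gf n (s : R) : 0 <= s <= 1 ->
  (\int[P]_w (s ^+ GW_Z xi n w)%:E = (iter n f s)%:E)%E.
Proof.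
elim: n s => [|n IH] s s01.
  under eq_integral do rewrite /= expr1.
  by have := expectation_cst P s; rewrite unlock.
have s0 : 0 <= s by case/andP: s01.
have disj : generations_before n `&` generation n `<=` set0.
  by move=> [[j l]|k] [] //= jn je; move: jn; rewrite je ltnn.
pose g k w : R := \prod_(i < k) s ^+ xi n i w.
have sg k : sub_measurable GW_family (generation n) (g k).
  apply: measurable_prod => i _.
  apply: (measurableT_comp (f := fun j : nat => s ^+ j)) => //.
  exact: sub_measurable_xi.
have g0 k w : 0 <= g k w by apply: prodr_ge0 => i _; exact: exprn_ge0.
have Eg k : (\int[P]_w (g k w)%:E = (f s ^+ k)%:E)%E.
  (* The first [l] individuals of generation [n]; a block smaller than the generation is needed to
     split off the last factor. *)
  pose C l : set ((nat * nat) + nat)%type :=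
    [set i | if i is inl (j, r) then j = n /\ (r < l)%N else False].
  have sC l : sub_measurable GW_family (C l) (g l).
    apply: measurable_prod => i _.
    apply: (measurableT_comp (f := fun j : nat => s ^+ j)) => //.
    exact: sub_measurable_xi.
  elim: k => [|k IHk].
    rewrite /g; under eq_integral do rewrite big_ord0.
    by have := expectation_cst P 1; rewrite unlock.
  rewrite /g; under eq_integral do rewrite big_ord_recr/=.
  have disjk : C k `&` [set inl (n, k)] `<=` set0.
    move=> i [Ci /= ie]; move: Ci; rewrite ie /= => -[_].
    by rewrite ltnn.
  have sk : sub_measurable GW_family [set inl (n, k)] (fun w => s ^+ xi n k w).
    apply: (measurableT_comp (f := fun j : nat => s ^+ j)) => //.
    exact: sub_measurable_xi.
  rewrite (ge0_expectation_indepM HY disjk (sC k) sk)//; last first.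
    by move=> w; exact: exprn_ge0.
  rewrite IHk (@ge0_integral_xi n k (fun j => s ^+ j) (f s)).
  - by rewrite -EFinM exprSr.
  - by move=> j; exact: exprn_ge0.
  - exact: offspring_gf_cvg.
transitivity (\int[P]_w (g (GW_Z xi n w) w)%:E)%E.
  by apply: eq_integral => w _; rewrite /= /g -expr_sum.
rewrite (ge0_expectation_subst HY disj (@sub_measurable_GW_Z n) sg g0).
under eq_integral do rewrite Eg.
rewrite IH; last by rewrite offspring_gf_ge0// offspring_gf_le1.
by rewrite -iterSr.
Qed.

Lemma GW_subst_psum n (D : nat -> set R) : (forall k, measurable (D k)) ->
  (P [set w | D (GW_Z xi n w) (psum X (GW_Z xi n w) w)] =
   \int[P]_w P [set v | D (GW_Z xi n w) (psum X (GW_Z xi n w) v)])%E.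
Proof.
move=> mD.
have disj : generations_before n `&` steps `<=` set0 by move=> [[j l]|k] [].
pose g k : T -> R := \1_[set w | D k (psum X k w)].
have sS k : sub_measurable GW_family steps (psum X k).
  apply: measurable_sum => i.
  have H : sub_measurable GW_family steps (GW_family (inr (i : nat))).
    exact: sub_measurable_proj.
  exact H.
have sg k : sub_measurable GW_family steps (g k).
  apply: (@measurable_indic _ (g_sigma_algebraType (cylinders GW_family steps))).
  by have := sS k measurableT _ (mD k); rewrite setTI.
have g0 k w : 0 <= g k w by rewrite /g.
have mS k : measurable [set w | D k (psum X k w)].
  by have := sub_measurable_fun HY (sS k) measurableT (mD k); rewrite setTI.
have := ge0_expectation_subst HY disj (@sub_measurable_GW_Z n) sg g0.
have mE : measurable [set w | D (GW_Z xi n w) (psum X (GW_Z xi n w) w)].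
  rewrite (_ : [set _ | _] = \bigcup_k (GW_Z xi n @^-1` [set k] `&`
      [set w | D k (psum X k w)])).
    apply: bigcup_measurable => k _; apply: measurableI => //.
    by rewrite -[X in measurable X]setTI; apply: measurable_GW_Z.
  apply/seteqP; split=> [w Dw|w [k _ [/= <-]]//]; by exists (GW_Z xi n w).
under [X in X = _]eq_integral => w _.
  rewrite (_ : g _ w = \1_[set w | D (GW_Z xi n w) (psum X (GW_Z xi n w) w)] w).
    over.
  rewrite /g !indicE; congr ((nat_of_bool _)%:R).
rewrite integral_indic// setIT => ->.
by apply: eq_integral => w _; rewrite integral_indic// setIT.
Qed.

End galton_watson.

(** * Gamma integrals and negative moments *)

Section gamma_integrals.
Context {R : realType}.
Local Notation leb := (@lebesgue_measure R).

Lemma powR_le_expR (r y : R) : 0 < r -> 0 < y -> y `^ r <= r `^ r * expR y.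
Proof.
move=> r0 y0; rewrite !powRE// -expRD ler_expR.
have := @le_ln1Dx R (y / r - 1); rewrite addrCA subrr addr0 => h.
have {}h : ln (y / r) <= y / r - 1.
  by apply: h; rewrite ltrBDr addrC subrr divr_gt0.
move: h; rewrite ln_div ?posrE// => h.
have : r * (ln y - ln r) <= r * (y / r - 1) by rewrite ler_wpM2l// ltW.
have -> : r * (y / r - 1) = y - r by field; rewrite gt_eqF.
lra.
Qed.

(** Up to [H] the bound [z <= 1] is enough; beyond it the stretched exponential beats [v^(s + 2)],
    by [powR_le_expR] with [r = (s + 2) / beta]. [K] depends on neither [z] nor [v], so one
    integrable function dominates all the [phi_n]. *)
Lemma laplace_domination (s h c beta : R) : 0 < s -> 0 < h -> 0 < c -> 0 < beta ->
  exists2 K : R, 0 < K & forall (z v : R), 0 < v -> 0 <= z <= 1 ->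
    (h <= v -> z <= expR (- (c * v `^ beta))) -> z * v `^ s <= K / (1 + v ^+ 2).
Proof.
move=> s0 h0 c0 b0.
pose H := Num.max h 1; pose r := (s + 2) / beta.
have r0 : 0 < r by rewrite divr_gt0// addr_gt0.
have H0 : 0 < H by rewrite lt_max h0.
exists (H `^ s * (1 + H ^+ 2) + 2 * (r `^ r * c `^ (- r))).
  by rewrite addr_gt0 ?mulr_gt0 ?powR_gt0// addr_gt0// exprn_gt0.
move=> z v v0 /andP[z0 z1] zv.
have v20 : 0 < 1 + v ^+ 2 by rewrite addr_gt0// exprn_gt0.
rewrite ler_pdivlMr//; have [vH|Hv] := leP v H.
  apply: le_trans (_ : H `^ s * (1 + H ^+ 2) <= _); last first.
    by rewrite lerDl !mulr_ge0 ?powR_ge0.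
  apply: ler_pM; rewrite ?mulr_ge0 ?powR_ge0 ?(ltW v20)//.
    rewrite -[leRHS]mul1r; apply: ler_pM; rewrite ?powR_ge0//.
    by apply: ge0_ler_powR; rewrite ?nnegrE ?(ltW s0) ?(ltW v0) ?(ltW H0).
  by rewrite lerD2l; apply: lerXn2r; rewrite ?nnegrE ?(ltW v0) ?(ltW H0).
have hv : h <= v by apply: ltW; apply: le_lt_trans Hv; rewrite le_max lexx.
have v1 : 1 <= v by apply: ltW; apply: le_lt_trans Hv; rewrite le_max lexx orbT.
have cv0 : 0 < c * v `^ beta by rewrite mulr_gt0 ?powR_gt0.
have key := powR_le_expR r0 cv0.
apply: le_trans (_ : 2 * (r `^ r * c `^ (- r)) <= _); last first.
  by rewrite lerDr mulr_ge0 ?powR_ge0// addr_ge0// sqr_ge0.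
have vs2 : v `^ s * v ^+ 2 = v `^ (s + 2).
  by rewrite -powR_mulrn ?(ltW v0)// -powRD// (gt_eqF v0)/= implybT.
have rb : (c * v `^ beta) `^ r = c `^ r * v `^ (s + 2).
  rewrite powRM ?powR_ge0 ?(ltW c0)// -powRrM; congr (_ * _ `^ _).
  by rewrite /r; field; rewrite gt_eqF.
apply: le_trans (_ : expR (- (c * v `^ beta)) * (2 * v `^ (s + 2)) <= _).
  rewrite -mulrA; apply: ler_pM; rewrite ?mulr_ge0 ?powR_ge0 ?(ltW v20) ?zv//.
  rewrite mulrDr mulr1 vs2.
  have : v `^ s <= v `^ (s + 2) by apply: ler_powR => //; lra.
  lra.
rewrite expRN mulrC ler_pdivrMr ?expR_gt0// -!mulrA ler_pM2l//.
rewrite mulrA [_ * c `^ _]mulrC -mulrA powRN mulrC.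
rewrite ler_pdivlMr ?powR_gt0// mulrC -rb; exact: key.
Qed.

Lemma integrable_oneDsqrV (K : R) :
  leb.-integrable `]0%R, +oo[ (fun v => (K / (1 + v ^+ 2))%:E).
Proof.
have H : leb.-integrable `[0%R, +oo[ (fun v : R => (oneDsqr v)^-1%:E).
  apply/integrableP; split.
    apply/measurable_EFinP; apply: measurable_funTS.
    apply: continuous_measurable_fun; exact: continuous_oneDsqrV.
  under eq_integral => v _.
    rewrite gee0_abs; last by rewrite lee_fin invr_ge0 (le_trans _ (oneDsqr_ge1 v)).
    over.
  by rewrite integral0y_oneDsqr ltry.
have H2 : leb.-integrable `]0%R, +oo[ (fun v : R => (oneDsqr v)^-1%:E).
  apply: integrableS H => //.
  by move=> v /=; rewrite !in_itv/= !andbT; exact: ltW.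
rewrite (_ : (fun v => _) = (fun v : R => K%:E * ((oneDsqr v)^-1)%:E)%E)//.
exact: integrableZl.
Qed.

Lemma gamma_finite (s : R) : 0 < s -> (Gamma_fun (s + 1) < +oo)%E.
Proof.
move=> s0; have [K K0 HK] := laplace_domination s0 ltr01 ltr01 ltr01.
have /integrableP[mK] := integrable_oneDsqrV K; apply: le_lt_trans.
apply: ge0_le_integral => //.
- by move=> v _; rewrite lee_fin mulr_ge0 ?powR_ge0 ?expR_ge0.
- apply/measurable_EFinP; apply: measurable_funM.
    by apply: measurable_funTS; exact: measurable_powR.
  by apply: measurable_funTS; apply: measurableT_comp.
- exact: measurableT_comp.
- move=> v; rewrite /= in_itv/= andbT => v0.
  rewrite lee_fin (le_trans _ (ler_norm _))// addrK mulrC; apply: HK => //.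
    by rewrite expR_ge0/= -[leRHS]expR0 ler_expR oppr_le0 ltW.
  by move=> _; rewrite mul1r powRr1// ltW.
Qed.

(** Substitution [x = u v]. As [s > 0], the integrand is continuous up to the origin, which
    substitution on the closed half-line requires. *)
Lemma gamma_scale (u s : R) : 0 < u -> 0 < s ->
  (\int[leb]_(v in `]0%R, +oo[) (expR (- (v * u)) * v `^ s)%:E =
   (u `^ (- (s + 1)))%:E * Gamma_fun (s + 1))%E.
Proof.
move=> u0 s0.
pose F (v : R) := u * v.
pose G (x : R) := expR (- x) * x `^ s.
have dF v : derivable F v 1 by apply: derivableM.
have F' : derive1 F = cst u.
  apply/funext => v; rewrite derive1E deriveM// derive_cst derive_id.
  by rewrite scaler0 addr0 /GRing.scale/= mulr1.
have cF : continuous F by move=> v; apply: cvgM; [exact: cvg_cst|exact: cvg_id].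
have cE (x : R) : {for x, continuous (fun y : R => expR (- y))}.
  apply: continuous_comp; last exact: continuous_expR.
  exact: opp_continuous.
have cG : {within `[0%R, +oo[, continuous G}.
  apply/continuous_within_itvcyP; split=> [x|].
    rewrite in_itv/= andbT => x0; apply: cvgM; first exact: cE.
    have cP : {for x, continuous (fun v : R => v `^ s)}.
      apply: differentiable_continuous; apply/derivable1_diffP.
      by apply: derivable_powR; rewrite in_itv/= x0.
    exact: cP.
  rewrite /G powR0 ?gt_eqF// ?(gtr_eqF s0)//.
  apply: cvgM; last exact: powR_cvg0.
  by apply: cvg_at_right_filter; exact: cE.
have mI (g : R -> R) : measurable_fun setT g ->
    measurable_fun (`]0%R, +oo[ : set R) (EFin \o g).
  by move=> mg; apply/measurable_EFinP; exact: measurable_funTS.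
have mG : measurable_fun setT G.
  by apply: measurable_funM; [exact: measurableT_comp|exact: measurable_powR].
have GammaE : Gamma_fun (s + 1) = (\int[leb]_(x in `[0%R, +oo[) (G x)%:E)%E.
  rewrite /Gamma_fun -integral_itv_obnd_cbnd; last exact: mI.
  by apply: eq_integral => x _; rewrite addrK mulrC.
have S : (\int[leb]_(x in `[(F 0)%R, +oo[) (G x)%:E =
    \int[leb]_(x in `[0%R, +oo[) (((G \o F) * derive1 F)%R x)%:E)%E.
  apply: increasing_ge0_integration_by_substitutiony.
  - by move=> x y _ _ xy; rewrite /F ltr_pM2l.
  - by rewrite F' => x _; exact: cst_continuous.
  - by rewrite F'; exact: is_cvg_cst.
  - by rewrite F'; exact: is_cvg_cst.
  - split; first by move=> x _; exact: dF.
    by apply: cvg_at_right_filter; exact: cF.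
  - apply/cvgryPge => A; exists (A / u); split; first exact: num_real.
    by move=> x /ltW; rewrite /F ler_pdivrMr// mulrC.
  - by rewrite /F mulr0.
  - by move=> x _; rewrite mulr_ge0 ?expR_ge0 ?powR_ge0.
have m1 : measurable_fun setT (fun v : R => expR (- (v * u)) * v `^ s).
  apply: measurable_funM; last exact: measurable_powR.
  by apply: measurableT_comp => //; apply: measurableT_comp => //; exact: measurable_funM.
move: S; rewrite /F mulr0 -GammaE => ->.
rewrite -integral_itv_obnd_cbnd; last first.
  by apply: mI; rewrite F'; apply: measurable_funM => //; apply: measurableT_comp => //;
    exact: measurable_funM.
rewrite (_ : (\int[leb]_(x in `]0%R, +oo[) (((G \o F) * derive1 F)%R x)%:E =
  (u `^ (s + 1))%:E * \int[leb]_(v in `]0%R, +oo[) (expR (- (v * u)) * v `^ s)%:E))%E.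
  by rewrite muleA -EFinM powRN mulVf ?mul1e// gt_eqF// powR_gt0.
rewrite -ge0_integralZl//; last 3 first.
- exact: mI.
- by move=> v _; rewrite lee_fin mulr_ge0 ?expR_ge0 ?powR_ge0.
- by rewrite lee_fin powR_ge0.
apply: eq_integral => v; rewrite inE/= in_itv/= andbT => v0.
rewrite F' fctE /= /G /F -EFinM; congr EFin.
rewrite powRM ?(ltW u0) ?(ltW v0)// powRD; last by rewrite (gt_eqF u0)/= implybT.
by rewrite powRr1 ?(ltW u0)// (mulrC v u); ring.
Qed.

Lemma gamma_gt0 (s : R) : 0 < s -> 0 < fine (Gamma_fun (s + 1)).
Proof.
move=> s0; have Gfin := gamma_finite s0.
have G0 : (0 <= Gamma_fun (s + 1))%E.
  by apply: integral_ge0 => v _; rewrite lee_fin mulr_ge0 ?powR_ge0 ?expR_ge0.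
apply: fine_gt0; rewrite Gfin andbT.
have mI : measurable (`[1%R, 2%R] : set R) by exact: measurable_itv.
apply: (@lt_le_trans _ _ (\int[leb]_(v in `[1%R, 2%R]) (expR (-2))%:E)%E).
  rewrite integral_cst//; apply: mule_gt0; first by rewrite lte_fin expR_gt0.
  suff : (0 < lebesgue_measure (`[1%R, 2%R] : set R))%E by [].
  by rewrite lebesgue_measure_itv/= lte_fin ltr1n/= -EFinD lte_fin; lra.
apply: le_trans (_ : (\int[leb]_(v in `[1%R, 2%R]) (v `^ (s + 1 - 1) * expR (- v))%:E <= _)%E).
  apply: ge0_le_integral => //.
  - by apply/measurable_EFinP; apply: measurable_funM; apply: measurable_funTS;
      [exact: measurable_powR|apply: measurableT_comp].
  move=> v /=; rewrite in_itv/= => /andP[v1 v2]; rewrite lee_fin addrK.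
  rewrite -[leLHS]mul1r; apply: ler_pM; rewrite ?expR_ge0 ?ler_expR ?lerN2//.
  have := @ge0_ler_powR R s (ltW s0) 1 v; rewrite powR1 !nnegrE; apply => //.
  exact: le_trans v1.
apply: ge0_subset_integral => //.
- by apply/measurable_EFinP; apply: measurable_funM; apply: measurable_funTS;
    [exact: measurable_powR|apply: measurableT_comp].
- by move=> v _; rewrite lee_fin mulr_ge0 ?powR_ge0 ?expR_ge0.
- by move=> v /=; rewrite !in_itv/= andbT => /andP[v1 _]; lra.
Qed.

(** Dominated convergence. It is also applied to constant sequences, where its first conclusion
    gives the integrability for a fixed [n]. *)
Lemma laplace_integral_cvg (s h c beta : R) (phi_ : nat -> R -> R) (phi : R -> R) :
  0 < s -> 0 < h -> 0 < c -> 0 < beta ->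
  (forall n, measurable_fun setT (phi_ n)) -> measurable_fun setT phi ->
  (forall n (v : R), 0 < v -> 0 <= phi_ n v <= 1) ->
  (forall n v, h <= v -> phi_ n v <= expR (- (c * v `^ beta))) ->
  (forall v : R, 0 < v -> phi_ n v @[n --> \oo] --> phi v) ->
  leb.-integrable `]0%R, +oo[ (fun v => (phi v * v `^ s)%:E) /\
  (\int[leb]_(v in `]0%R, +oo[) (phi_ n v * v `^ s)%:E @[n --> \oo] -->
   \int[leb]_(v in `]0%R, +oo[) (phi v * v `^ s)%:E)%E.
Proof.
move=> s0 h0 c0 b0 mphi_ mphi phi01 phidec phicvg.
have [K K0 HK] := laplace_domination s0 h0 c0 b0.
have mm (g : R -> R) : measurable_fun setT g ->
    measurable_fun (`]0%R, +oo[ : set R) (fun v => (g v * v `^ s)%:E).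
  move=> mg; apply/measurable_EFinP; apply: measurable_funTS.
  by apply: measurable_funM => //; exact: measurable_powR.
have [] := @dominated_convergence _ _ R leb `]0%R, +oo[ (measurable_itv _)
  (fun n v => (phi_ n v * v `^ s)%:E) (fun v => (phi v * v `^ s)%:E)
  (fun v => (K / (1 + v ^+ 2))%:E).
- by move=> n; exact: mm.
- exact: mm.
- apply/aeW => v; rewrite /= in_itv/= andbT => v0.
  apply: cvg_EFin; first exact: nearW.
  by apply: cvgMl; exact: phicvg.
- exact: integrable_oneDsqrV.
- apply/aeW => v n; rewrite /= in_itv/= andbT => v0.
  have /andP[p0 p1] := phi01 n v v0.
  rewrite lee_fin ger0_norm ?mulr_ge0 ?powR_ge0//; apply: HK => //.
    by rewrite p0.
  exact: phidec.
by move=> iphi _ lim; split.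
Qed.

End gamma_integrals.

(** * Laplace transforms and negative moments of a random variable *)

Section laplace_transform.
Context {d : measure_display} {T : measurableType d} {R : realType}.
Variable P : probability T R.
Variable U : T -> R.
Hypothesis mU : measurable_fun setT U.
Local Notation leb := (@lebesgue_measure R).

Definition laplace (v : R) : R := fine (\int[P]_w (expR (- (v * U w)))%:E)%E.

Lemma laplaceE (v : R) : 0 < v -> {ae P, forall w, 0 <= U w} ->
  (\int[P]_w (expR (- (v * U w)))%:E = (laplace v)%:E)%E /\ 0 <= laplace v <= 1.
Proof.
move=> v0 U0.
have I0 : (0 <= \int[P]_w (expR (- (v * U w)))%:E)%E.
  by apply: integral_ge0 => w _; rewrite lee_fin expR_ge0.
have I1 : (\int[P]_w (expR (- (v * U w)))%:E <= 1)%E.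
  have <- : (\int[P]_w 1%:E = 1)%E by have := expectation_cst P 1; rewrite unlock.
  apply: ae_ge0_le_integral => //.
  - apply/measurable_EFinP; apply: measurableT_comp => //.
    by apply: measurableT_comp => //; exact: measurable_funM.
  - apply: filterS U0 => w Uw _; rewrite lee_fin -[leRHS]expR0 ler_expR oppr_le0.
    by rewrite mulr_ge0// ltW.
have Ifin : (\int[P]_w (expR (- (v * U w)))%:E \is a fin_num)%E.
  by rewrite ge0_fin_numE//; apply: le_lt_trans I1 _; rewrite ltry.
rewrite -lee_fin -lee_fin /laplace fineK//; split => //.
by rewrite I0 I1.
Qed.

(** The indicator extends the integral in [v] to the whole line, so that Tonelli's theorem applies
    on the product with Lebesgue measure. *)
Let g (s : R) (x : T * R) : \bar R :=
  (expR (- (x.2 * U x.1)) * (x.2 `^ s * \1_(`]0%R, +oo[ : set R) x.2))%:E.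

Let mg s : measurable_fun setT (g s).
Proof.
apply/measurable_EFinP; apply: measurable_funM.
  apply: measurableT_comp => //; apply: measurableT_comp => //.
  apply: measurable_funM; first exact: measurable_snd.
  by apply: measurableT_comp => //; exact: measurable_fst.
apply: (measurableT_comp (f := fun v : R => v `^ s * \1_(`]0%R, +oo[ : set R) v)) => //.
apply: measurable_funM; first exact: measurable_powR.
by apply: measurable_indic; exact: measurable_itv.
Qed.

Lemma measurable_laplace : measurable_fun setT laplace.
Proof.
pose g' (x : T * R) : \bar R := (expR (- (x.2 * U x.1)))%:E.
have mg' : measurable_fun setT g'.
  apply/measurable_EFinP.
  apply: measurableT_comp => //; apply: measurableT_comp => //.
  apply: measurable_funM; first exact: measurable_snd.
  by apply: measurableT_comp => //; exact: measurable_fst.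
apply: (measurableT_comp (f := fine)); first exact: fine_measurable.
apply: (@measurable_fun_fubini_tonelli_G _ _ T _ R P g') => //.
by move=> x; rewrite lee_fin expR_ge0.
Qed.

(** [gamma_scale] writes [u^(- (s + 1))] as a mixture of the functions [exp(- u v)]; the two
    integrals are then exchanged. *)
Lemma negative_moment_laplace (s : R) : 0 < s -> {ae P, forall w, 0 < U w} ->
  (\int[P]_w ((U w) `^ (- (s + 1)))%:E * Gamma_fun (s + 1) =
   \int[leb]_(v in `]0%R, +oo[) (laplace v * v `^ s)%:E)%E.
Proof.
move=> s0 U0.
have G0 : (0 <= Gamma_fun (s + 1) :> \bar R)%E.
  by apply: integral_ge0 => v _; rewrite lee_fin mulr_ge0 ?powR_ge0 ?expR_ge0.
have g0 x : (0 <= g s x)%E.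
  by rewrite lee_fin !mulr_ge0 ?expR_ge0 ?powR_ge0// indicE.
have mkc (k : R -> R) : (\int[leb]_(v in `]0%R, +oo[) (k v)%:E =
    \int[leb]_v (k v * \1_(`]0%R, +oo[ : set R) v)%:E)%E.
  rewrite integral_mkcond; apply: eq_integral => v _.
  rewrite patchE indicE; case: ifPn => _; rewrite ?mulr1 ?mulr0//.
have FT := @fubini_tonelli _ _ T _ R P leb (g s) (mg s) g0.
rewrite -ge0_integralZr//; last 2 first.
- apply/measurable_EFinP; apply: (measurableT_comp (measurable_powR _)); exact: mU.
- by move=> w _; rewrite lee_fin powR_ge0.
transitivity (\int[P]_w \int[leb]_v (g s (w, v)))%E.
  apply: ae_eq_integral => //.
  - apply: emeasurable_funM => //; apply/measurable_EFinP.
    by apply: (measurableT_comp (measurable_powR _)); exact: mU.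
  - by apply: (measurable_fun_fubini_tonelli_F (m2 := leb) (g s)) => //; exact: mg.
  - apply: filterS U0 => w Uw _; rewrite -gamma_scale// mkc.
    by apply: eq_integral => v _; rewrite /g /= mulrA.
rewrite FT mkc; apply: eq_integral => v _.
rewrite /g /=; under eq_integral do rewrite EFinM.
rewrite ge0_integralZr//; last 2 first.
- apply/measurable_EFinP; apply: measurableT_comp => //.
  by apply: measurableT_comp => //; exact: measurable_funM.
- by rewrite lee_fin mulr_ge0 ?powR_ge0// indicE.
have [v0|v0] := ltP 0 v; last first.
  by rewrite indicE memNset ?mulr0 ?mule0//= in_itv/= andbT; apply/negP; rewrite -leNgt.
have U0' : {ae P, forall w, 0 <= U w} by apply: filterS U0 => w; exact: ltW.
by have [-> _] := laplaceE v0 U0'; rewrite -EFinM mulrA.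
Qed.

End laplace_transform.

(** * The limit theorem *)

Section thresholds.
Context {R : realType}.

Lemma natr_eventually_ge (A : R) : exists N : nat, forall n, (N <= n)%N -> A <= n%:R.
Proof.
exists (Num.truncn A).+1 => n Nn; apply: ltW.
by apply: lt_le_trans (truncnS_gt A) _; rewrite ler_nat.
Qed.

Lemma exprn2_eventually_ge (A : R) : 0 < A ->
  exists N : nat, forall n, (N <= n)%N -> A * n%:R <= 2 ^+ n.
Proof.
move=> A0.
have l2 : 0 < ln 2 :> R by rewrite ln_gt0// ltr1n.
pose c : R := 2 `^ 2.
have c0 : 0 < c by exact: powR_gt0.
have [N HN] := natr_eventually_ge (A * c / (ln 2) ^+ 2).
exists N.+1 => n Nn; have n0 : 0 < n%:R :> R by rewrite ltr0n (leq_ltn_trans _ Nn).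
have := @powR_le_expR R 2 (n%:R * ln 2) (ltr0Sn _ 1); rewrite mulr_gt0// => /(_ isT).
rewrite expRM_natl lnK ?posrE// -/c.
rewrite (powR_mulrn 2) ?mulr_ge0 ?(ltW n0) ?(ltW l2)// => h.
rewrite -(ler_pM2l c0); apply: le_trans h.
have := HN n (ltnW Nn); rewrite ler_pdivrMr ?exprn_gt0// => h.
rewrite exprMn expr2 mulrA [leRHS]mulrAC.
by rewrite ler_wpM2r ?(ltW n0)// mulrC.
Qed.

Variables (m beta : R) (eps : nat -> R).
Hypothesis m1 : 1 < m.
Hypothesis beta0 : 0 < beta.
Hypothesis beta1 : beta <= 1.
Hypothesis eps0 : forall n, 0 < eps n.
Hypothesis Heps : (eps n * m `^ (n%:R / 2) * n%:R `^ (- (2 * beta)^-1))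
  @[n --> \oo] --> +oo.

(** The quantity [om] assumed to diverge is eventually at least [max(1, A)], so [om^2 >= om >= A];
    squaring it produces [eps_n^2 m^n n^(- 1/beta)]. *)
Lemma eps_growth (A : R) : exists N : nat, forall n, (N <= n)%N ->
  (0 < n)%N /\ A * n%:R `^ beta^-1 <= eps n ^+ 2 * m ^+ n.
Proof.
have m0 : 0 < m by exact: lt_trans m1.
have /cvgryPge/(_ (Num.max 1 A))[N _ HN] := Heps.
exists N.+1 => n Nn; have n0 : (0 < n)%N by exact: leq_ltn_trans Nn.
have nr0 : 0 < n%:R :> R by rewrite ltr0n.
split=> //; have /= := HN n (ltnW Nn).
set om := (X in _ <= X); rewrite ge_max => /andP[om1 omA].
have -> : eps n ^+ 2 * m ^+ n = om ^+ 2 * n%:R `^ beta^-1.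
  have e1 : (m `^ (n%:R / 2)) ^+ 2 = m ^+ n.
    rewrite -powR_mulrn ?powR_ge0// -powRrM -powR_mulrn ?(ltW m0)//.
    by congr (_ `^ _); field.
  have e2 : (n%:R `^ (- (2 * beta)^-1)) ^+ 2 * n%:R `^ beta^-1 = 1.
    rewrite -powR_mulrn ?powR_ge0// -powRrM -powRD; last first.
      by rewrite (gt_eqF nr0)/= implybT.
    rewrite (_ : _ + _ = 0) ?powRr0//; field; rewrite gt_eqF//.
  have -> : om ^+ 2 * n%:R `^ beta^-1 = eps n ^+ 2 * (m `^ (n%:R / 2)) ^+ 2 *
      ((n%:R `^ (- (2 * beta)^-1)) ^+ 2 * n%:R `^ beta^-1) by rewrite /om; ring.
  by rewrite e1 e2 mulr1.
rewrite ler_wpM2r ?powR_ge0//; apply: le_trans omA _.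
by rewrite expr2 ler_peMl// (le_trans _ om1).
Qed.

(** With [Q = eps_n^2 k] and [x = eps_n k], [x^2 = k Q] and [2 ln x = ln k + ln Q], so [M ln Q <= Q]
    and [M ln k <= Q] suffice. The first holds because [Q >= n] is large. For [k <= m^n],
    [ln k <= n ln m]. For [k = m^n y] with [y > 1], [ln k <= n ln m + y], whereas [Q] is at least a
    multiple of [n y], by [eps_growth] and [n <= n^(1/beta)], that is, [beta <= 1]. *)
Lemma good_region (M : R) : 0 < M -> exists2 M' : R, 0 < M' &
  exists N : nat, forall n k, (N <= n)%N -> (0 < k)%N ->
    M' * n%:R <= eps n ^+ 2 * k%:R ->
    M <= eps n * k%:R /\
    M * k%:R * ln (eps n * k%:R) <= (eps n * k%:R) ^+ 2.
Proof.
move=> M0; have m0 : 0 < m by exact: lt_trans m1.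
have m1' := m1.
have lm : 0 < ln m by exact: ln_gt0.
pose M1 := M * (ln m + 1).
have M10 : 0 < M1 by rewrite mulr_gt0// addr_gt0.
exists (M1 + 1); first by rewrite addr_gt0.
have [N1 HN1] := eps_growth M1.
have [N2 HN2] := natr_eventually_ge (4 * M ^+ 2).
exists (maxn N1 N2) => n k; rewrite geq_max => /andP[nN1 nN2] k0.
have [n0 epsn] := HN1 n nN1; have n4M := HN2 n nN2.
have e0 := eps0 n.
have kr1 : 1 <= k%:R :> R by rewrite ler1n.
have kr0 : 0 < k%:R :> R by lra.
have nr1 : 1 <= n%:R :> R by rewrite ler1n.
have mn0 : 0 < m ^+ n by exact: exprn_gt0.
set Q := eps n ^+ 2 * k%:R => Qge.
have Qn : n%:R <= Q.
  by apply: le_trans Qge; rewrite ler_peMl//; lra.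
have Q0 : 0 < Q by lra.
have x0 : 0 < eps n * k%:R by rewrite mulr_gt0.
have xQ : (eps n * k%:R) ^+ 2 = k%:R * Q by rewrite /Q; ring.
have lnx : 2 * ln (eps n * k%:R) = ln k%:R + ln Q.
  by rewrite -lnM ?posrE// -xQ lnXn// mulr2n; ring.
have lnQ : M * ln Q <= Q.
  have := @ln_le_powR R 2^-1 Q; rewrite invr_gt0 ltr0n => /(_ isT Q0).
  rewrite invrK powR12_sqrt ?(ltW Q0)// => h.
  have sQ : Num.sqrt Q ^+ 2 = Q by rewrite sqr_sqrtr// ltW.
  have s0 : 0 <= Num.sqrt Q by exact: sqrtr_ge0.
  have sM : 2 * M <= Num.sqrt Q.
    rewrite -(@ler_pXn2r _ 2) ?nnegrE ?mulr_ge0 ?(ltW M0)// sQ exprMn.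
    by apply: le_trans Qn; apply: le_trans n4M; lra.
  have h1 : M * ln Q <= M * (2 * Num.sqrt Q) by rewrite ler_wpM2l// ltW.
  have h2 : 2 * M * Num.sqrt Q <= Num.sqrt Q * Num.sqrt Q by rewrite ler_wpM2r.
  rewrite -[leRHS]sQ expr2; lra.
have lnk : M * ln k%:R <= Q.
  have [km|mk] := leP k%:R (m ^+ n).
    have : ln k%:R <= n%:R * ln m.
      by rewrite mulr_natl -lnXn// ler_ln ?posrE.
    move=> h; have : M * ln k%:R <= M * (n%:R * ln m) by rewrite ler_wpM2l// ltW.
    have := Qge; rewrite /M1.
    have : 0 <= M * n%:R by rewrite mulr_ge0// ltW.
    nra.
  pose y := k%:R / m ^+ n.
  have y1 : 1 <= y by rewrite ler_pdivlMr// mul1r ltW.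
  have kE : k%:R = m ^+ n * y by rewrite /y mulrC divfK// gt_eqF.
  have lk : ln k%:R <= n%:R * ln m + y.
    rewrite kE lnM ?posrE//; last lra.
    rewrite lnXn// mulr_natl lerD2l.
    have := @le_ln1Dx R (y - 1); rewrite addrCA subrr addr0 => h.
    by apply: le_trans (h _) _; lra.
  have Qy : M1 * n%:R * y <= Q.
    rewrite /Q kE mulrA ler_wpM2r//; first lra.
    apply: le_trans epsn; rewrite ler_wpM2l// ?(ltW M10)//.
    apply: le1r_powR => //; rewrite invf_ge1//.
  apply: le_trans Qy; rewrite /M1.
  apply: le_trans (_ : M * (n%:R * ln m + y) <= _).
    by rewrite ler_wpM2l// ltW.
  rewrite -!mulrA ler_wpM2l ?(ltW M0)//.
  have p1 : n%:R * ln m * 1 <= n%:R * ln m * y.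
    by rewrite ler_wpM2l// mulr_ge0// ltW.
  have p2 : 1 * y <= n%:R * y by rewrite ler_wpM2r//; lra.
  have -> : (ln m + 1) * (n%:R * y) = n%:R * ln m * y + n%:R * y by ring.
  lra.
split.
  rewrite -(@ler_pXn2r _ 2) ?nnegrE ?(ltW M0) ?(ltW x0)// xQ.
  apply: le_trans (_ : Q <= _); last by rewrite ler_peMl// ltW.
  apply: le_trans Qn; apply: le_trans n4M.
  have := sqr_ge0 M; lra.
rewrite xQ mulrAC mulrC ler_wpM2l ?(ltW kr0)//.
by rewrite -(@ler_pM2l _ 2)// mulrCA lnx; lra.
Qed.

End thresholds.

(** * Combining the population and walk estimates *)

Section ratio_asymptotics.
Context {d : measure_display} {T : measurableType d} {R : realType}.
Variable P : probability T R.
Variables (p : nat -> R) (m : R) (mu : nat) (beta : R).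
Variables (xi : nat -> nat -> T -> nat) (X : nat -> T -> R) (W : T -> R).
Variables (theta a : R) (eps : nat -> R).
Hypothesis Hp0 : forall k, 0 <= p k.
Hypothesis Hpsum : (\sum_(k < n) p k) @[n --> \oo] --> (1 : R).
Hypothesis Hm : (\sum_(k < n) k%:R * p k) @[n --> \oo] --> m.
Hypothesis Hm1 : 1 < m.
Hypothesis HLlogL : cvg ((\sum_(k < n) k%:R * ln k%:R * p k) @[n --> \oo]).
Hypothesis Hbott : p 0%N = 0 /\ p 1%N = 0.
Hypothesis Hmu : 0 < p mu /\ (forall k, (k < mu)%N -> p k = 0).
Hypothesis Hbeta : mu%:R = m `^ beta.
Hypothesis HY : mutually_independent P (GW_family xi X).
Hypothesis Hxi_law : forall n i k, P [set w | xi n i w = k] = (p k)%:E.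
Hypothesis Htheta : 2 < theta.
Hypothesis Ha : 0 < a.
Hypothesis HWmeas : measurable_fun setT W.
Hypothesis HW : {ae P, forall w,
  ((GW_Z xi n w)%:R / m ^+ n) @[n --> \oo] --> W w}.

Let m0 : 0 < m. Proof. exact: lt_trans Hm1. Qed.
Let mX n : 0 < m ^+ n. Proof. exact: exprn_gt0. Qed.
Let b0 : 0 < beta. Proof. exact: beta_gt0 Hm1 Hbott Hmu Hbeta. Qed.
Let b1 : beta <= 1. Proof. exact: beta_le1 Hp0 Hpsum Hm Hm1 Hmu Hbeta. Qed.
Let mu2 : (2 <= mu)%N. Proof. exact: mu_ge2 Hbott Hmu. Qed.
Let mZ n : measurable_fun setT (GW_Z xi n).
Proof. exact: (@measurable_GW_Z _ _ _ _ _ _ HY n). Qed.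
Let mZr n : measurable_fun setT (fun w => (GW_Z xi n w)%:R : R).
Proof. exact: (@measurable_GW_Z_natr _ _ _ _ _ _ HY n). Qed.

Local Notation f := (offspring_gf p).
Local Notation Z n w := (GW_Z xi n w).

(** Read off the generating function: [E s^(Z_n) <= s^(mu^n)], while on [Z_n < mu^n] the variable
    [s^(Z_n)] is at least [s^(mu^n - 1)]. Thus this event has probability at most [s] for every [s]
    in []0, 1]]. *)
Lemma GW_Z_ge_ae n : {ae P, forall w, (mu ^ n <= Z n w)%N}.
Proof.
pose A := [set w | (Z n w < mu ^ n)%N].
have mA : measurable A.
  rewrite (_ : A = GW_Z xi n @^-1` [set k | (k < mu ^ n)%N])//.
  by rewrite -[X in measurable X]setTI; apply: mZ.
have mun0 : (0 < mu ^ n)%N by rewrite expn_gt0 (ltn_trans _ mu2).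
have PA (s : R) : 0 < s -> s <= 1 -> prob P A <= s.
  move=> s0 s1; have s01 : 0 <= s <= 1 by rewrite ltW.
  have H : (\int[P]_w (s ^+ (mu ^ n).-1 * \1_A w)%:E <= (s ^+ (mu ^ n))%:E)%E.
    apply: le_trans (_ : (\int[P]_w (s ^+ Z n w)%:E <= _)%E).
      apply: ge0_le_integral => //.
      - by move=> w _; rewrite lee_fin mulr_ge0// exprn_ge0// ltW.
      - apply/measurable_EFinP; apply: measurable_funM => //.
      - apply/measurable_EFinP.
        exact: (measurableT_comp (f := fun j : nat => s ^+ j)).
      - move=> w _; rewrite lee_fin indicE.
        case: (boolP (w \in A)) => [/set_mem wA|_].
          rewrite mulr1; apply: ler_wiXn2l; rewrite ?(ltW s0)//.
          by rewrite -ltnS prednK.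
        by rewrite mulr0 exprn_ge0// ltW.
    rewrite (GW_gf HY Hp0 Hpsum Hxi_law n s01) lee_fin.
    exact: iter_gf_le_pow.
  move: H; under eq_integral do rewrite EFinM.
  rewrite ge0_integralZl//; last 2 first.
  - by apply/measurable_EFinP; exact: measurable_indic.
  - by rewrite lee_fin exprn_ge0// ltW.
  rewrite integral_indic// setIT.
  rewrite [X in (_ * X)%E](_ : _ = (prob P A)%:E); last exact: probE.
  rewrite -EFinM lee_fin -[in leRHS](prednK mun0) exprSr ler_pM2l//.
  exact: exprn_gt0.
have PA0 : prob P A = 0.
  apply/eqP; rewrite eq_le prob_ge0 andbT leNgt; apply/negP => PA0.
  have [A1|A1] := leP (prob P A / 2) 1.
    by have := PA _ (divr_gt0 PA0 (ltr0Sn _ 1)) A1; lra.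
  by have := PA 1 ltr01 (lexx _); lra.
exists A; split => //; first by rewrite probE// PA0.
by move=> w /=; rewrite /A /= ltnNge => /negP.
Qed.

Lemma laplace_GW_Z n (v : R) : 0 < v ->
  laplace P (fun w => (Z n w)%:R / m ^+ n) v = iter n f (expR (- (v / m ^+ n))).
Proof.
move=> v0; rewrite /laplace.
under eq_integral => w _.
  rewrite (_ : - (v * _) = (Z n w)%:R * - (v / m ^+ n)); last by ring.
  rewrite expRM_natl; over.
rewrite (GW_gf HY Hp0 Hpsum Hxi_law n)//.
by rewrite expR_ge0/= -[leRHS]expR0 ler_expR oppr_le0 divr_ge0 ?(ltW v0) ?(ltW (mX n)).
Qed.

Lemma laplace_GW_Z_cvg (v : R) : 0 < v ->
  laplace P (fun w => (Z n w)%:R / m ^+ n) v @[n --> \oo] --> laplace P W v.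
Proof.
move=> v0.
have mU n : measurable_fun setT (fun w => (Z n w)%:R / m ^+ n : R).
  exact: measurable_funM.
have mE (U : T -> R) : measurable_fun setT U ->
    measurable_fun setT (fun w => (expR (- (v * U w)))%:E).
  move=> mU'; apply/measurable_EFinP; apply: measurableT_comp => //.
  by apply: measurableT_comp => //; exact: measurable_funM.
have W0 : {ae P, forall w, 0 <= W w}.
  apply: filterS HW => w Hw; rewrite -(cvg_lim _ Hw)//.
  apply: limr_ge; first exact: cvgP Hw.
  by apply: nearW => n; rewrite divr_ge0// ltW.
have [] := @dominated_convergence _ _ R P setT measurableT
  (fun n w => (expR (- (v * ((Z n w)%:R / m ^+ n))))%:E)
  (fun w => (expR (- (v * W w)))%:E) (cst 1%E)
  (fun n => mE _ (mU n)) (mE _ HWmeas).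
- apply: filterS HW => w Hw _; apply: cvg_EFin; first exact: nearW.
  apply: continuous_cvg; first exact: continuous_expR.
  by apply: cvgN; apply: cvgMr.
- exact: finite_measure_integrable_cst.
- apply/aeW => w n _; rewrite lee_fin ger0_norm ?expR_ge0//.
  rewrite -[leRHS]expR0 ler_expR oppr_le0 mulr_ge0 ?(ltW v0)// divr_ge0//.
  exact: ltW.
have [-> _] := laplaceE HWmeas v0 W0.
by move=> _ _ /fine_cvg.
Qed.

Lemma GW_scaled_gt0_ae n : {ae P, forall w, 0 < (Z n w)%:R / m ^+ n :> R}.
Proof.
apply: filterS (GW_Z_ge_ae n) => w Zge; rewrite divr_gt0// ltr0n.
by apply: leq_trans Zge; rewrite expn_gt0 (ltn_trans _ mu2).
Qed.

(** The limit constant is packaged as a real number, which lets the remaining argument take place in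
    [R]. *)
Lemma negative_moment_cvg : exists I : R,
  [/\ ((fine (Gamma_fun (theta - 1)))^-1%:E *
        \int[@lebesgue_measure R]_(v in `]0%R, +oo[)
          ('E_P[(fun w => expR (- v * W w))%R] * (v `^ (theta - 2))%:E) = I%:E)%E,
      (forall n, \int[P]_w (((Z n w)%:R / m ^+ n) `^ (- (theta - 1)))%:E \is a fin_num)%E &
      fine (\int[P]_w (((Z n w)%:R / m ^+ n) `^ (- (theta - 1)))%:E)%E
        @[n --> \oo] --> I].
Proof.
pose s := theta - 2.
have s0 : 0 < s by rewrite subr_gt0.
have sE : theta - 1 = s + 1 by rewrite /s; ring.
rewrite sE -/s.
set G := fine (Gamma_fun (s + 1)).
have G0 : 0 < G by exact: gamma_gt0.
have GE : Gamma_fun (s + 1) = G%:E.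
  rewrite fineK// ge0_fin_numE; first exact: gamma_finite.
  by apply: integral_ge0 => v _; rewrite lee_fin mulr_ge0 ?powR_ge0 ?expR_ge0.
pose U n w : R := (Z n w)%:R / m ^+ n.
have mU n : measurable_fun setT (U n) by exact: measurable_funM.
have U0 n : {ae P, forall w, 0 <= U n w}.
  by apply/aeW => w; rewrite divr_ge0// ltW.
have [h [c [h0 c0 dec]]] := iter_gf_decay Hp0 Hpsum Hm Hm1 HLlogL Hbott Hmu Hbeta.
have L01 n (v : R) : 0 < v -> 0 <= laplace P (U n) v <= 1.
  by move=> v0; have [] := laplaceE (mU n) v0 (U0 n).
have Ldec n (v : R) : h <= v -> laplace P (U n) v <= expR (- (c * v `^ beta)).
  move=> hv; have v0 : 0 < v by exact: lt_le_trans hv.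
  by rewrite laplace_GW_Z//; exact: dec.
have [iW cW] := @laplace_integral_cvg R s h c beta (fun n => laplace P (U n))
  (laplace P W) s0 h0 c0 b0 (fun n => measurable_laplace P (mU n))
  (measurable_laplace P HWmeas) L01 Ldec laplace_GW_Z_cvg.
have iU n : lebesgue_measure.-integrable `]0%R, +oo[
    (fun v => (laplace P (U n) v * v `^ s)%:E).
  have [] // := @laplace_integral_cvg R s h c beta (fun _ => laplace P (U n))
    (laplace P (U n)) s0 h0 c0 b0 (fun=> measurable_laplace P (mU n))
    (measurable_laplace P (mU n)) (fun=> L01 n) (fun=> Ldec n).
  by move=> v _; exact: cvg_cst.
set IW := (\int[lebesgue_measure]_(v in `]0%R, +oo[) (laplace P W v * v `^ s)%:E)%E in cW.
pose r n := fine (\int[lebesgue_measure]_(v in `]0%R, +oo[)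
  (laplace P (U n) v * v `^ s)%:E)%E.
have JE n : (\int[P]_w (U n w `^ (- (s + 1)))%:E = (r n / G)%:E)%E.
  have := negative_moment_laplace (mU n) s0 (GW_scaled_gt0_ae n); rewrite GE => nm.
  have cancel (j : \bar R) : j = (j * G%:E * G^-1%:E)%E.
    by rewrite -muleA -EFinM mulfV ?gt_eqF// mule1.
  apply: etrans (cancel _) _.
  by rewrite nm EFinM fineK//; exact: integrable_fin_num.
have IWfin : IW \is a fin_num by exact: integrable_fin_num.
exists (fine IW / G); split.
- rewrite mulrC EFinM fineK//; congr (_ * _)%E; apply: eq_integral => v.
  rewrite inE/= in_itv/= andbT => v0.
  have W0 : {ae P, forall w, 0 <= W w}.
    apply: filterS HW => w Hw; rewrite -(cvg_lim _ Hw)//.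
    apply: limr_ge; first exact: cvgP Hw.
    by apply: nearW => n; rewrite divr_ge0// ltW.
  rewrite [RHS]EFinM; have [<- _] := laplaceE HWmeas v0 W0.
  rewrite unlock; congr (_ * _)%E.
  by apply: eq_integral => w _; rewrite mulNr.
- by move=> n; rewrite JE.
- under eq_fun do rewrite JE /=.
  apply: cvgMl; apply: fine_cvg; rewrite fineK//.
Qed.

Hypothesis Heps_pos : forall n, 0 < eps n.
Hypothesis Heps : (eps n * m `^ (n%:R / 2) * n%:R `^ (- (2 * beta)^-1))
  @[n --> \oo] --> +oo.

Lemma measurable_small_population n (y : R) :
  measurable [set w | eps n ^+ 2 * (Z n w)%:R < y].
Proof.
have mg : measurable_fun setT (fun w => eps n ^+ 2 * (Z n w)%:R) by exact: measurable_funM.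
have := mg measurableT _ (measurable_itv `]-oo, y[); rewrite setTI.
by congr measurable; apply/seteqP; split=> w /=; rewrite in_itv.
Qed.

(* Chernoff's bound at [(lambda n)^(1/beta)], where the Laplace transform decays
   like [exp(- c lambda n)]. *)
Lemma small_population_negligible (M' : R) : 0 < M' ->
  exists N : nat, forall n, (N <= n)%N ->
    m `^ ((theta - 1) * n%:R) *
    prob P [set w | eps n ^+ 2 * (Z n w)%:R < M' * n%:R] <= expR (- n%:R).
Proof.
move=> M'0; have th2 := Htheta; have bp := b0; have mp := m0.
have lm : 0 < ln m by exact: ln_gt0.
have [h0 [c [h00 c0 dec]]] := iter_gf_decay Hp0 Hpsum Hm Hm1 HLlogL Hbott Hmu Hbeta.
(* [c lam n] pays for [m^((theta - 1) n)], for the Chernoff factor [exp(n)] and for the remaining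
   [exp(- n)]. *)
pose lam := ((theta - 1) * ln m + 2) / c.
have lam0 : 0 < lam.
  by rewrite divr_gt0// addr_gt0// mulr_gt0//; lra.
have [N1 HN1] := eps_growth Hm1 b0 Heps (lam `^ beta^-1 * M').
have [N2 HN2] := natr_eventually_ge (h0 `^ beta / lam).
exists (maxn N1 N2) => n; rewrite geq_max => /andP[nN1 nN2].
have [n0 grow] := HN1 n nN1.
have := HN2 n nN2; rewrite ler_pdivrMr// => hn.
have nr0 : 0 < n%:R :> R by rewrite ltr0n.
have ln0 : 0 <= lam * n%:R by rewrite mulr_ge0// ltW.
have e0 := Heps_pos n; have mn0 := mX n.
have em0 : 0 < eps n ^+ 2 * m ^+ n by rewrite mulr_gt0// exprn_gt0.
pose h := (lam * n%:R) `^ beta^-1.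
have hb : h `^ beta = lam * n%:R.
  by rewrite -powRrM mulVf ?gt_eqF// powRr1.
have hh0 : h0 <= h.
  have := @ge0_ler_powR R beta^-1 _ (h0 `^ beta) (lam * n%:R).
  rewrite invr_ge0 !nnegrE powR_ge0 mulrC => /(_ (ltW bp) isT).
  rewrite -powRrM mulfV ?gt_eqF// powRr1 ?(ltW h00)// /h [lam * _]mulrC; apply => //.
  by rewrite mulrC.
have hp : 0 < h by exact: lt_le_trans hh0.
pose y := M' * n%:R / (eps n ^+ 2 * m ^+ n).
(* The growth condition enters here: [h] is of order [n^(1/beta)] and [y] of order
   [n / (eps_n^2 m^n)]. *)
have hy : h * y <= n%:R.
  rewrite /y mulrA ler_pdivrMr// mulrCA mulrA -/h.
  rewrite [leLHS](_ : _ = n%:R * (lam `^ beta^-1 * M' * n%:R `^ beta^-1)).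
    by rewrite ler_wpM2l ?(ltW nr0).
  by rewrite /h powRM ?(ltW lam0) ?(ltW nr0)//; ring.
pose U w : R := (Z n w)%:R / m ^+ n.
have mU : measurable_fun setT U by exact: measurable_funM.
have U0 : {ae P, forall w, 0 <= U w}.
  by apply/aeW => w; rewrite divr_ge0// ltW.
set A := [set w | _ < _].
have mA : measurable A by exact: measurable_small_population.
have [LE _] := laplaceE mU hp U0.
have PA : prob P A <= expR (h * y) * laplace P U h.
  rewrite -lee_fin -probE// EFinM -LE.
  rewrite -[X in P X]setIT -integral_indic// -ge0_integralZl//; last first.
    apply/measurable_EFinP; apply: measurableT_comp => //.
    by apply: measurableT_comp => //; exact: measurable_funM.
  apply: ge0_le_integral => //.
  - by apply/measurable_EFinP; exact: measurable_indic.
  - apply: measurable_funeM; apply/measurable_EFinP; apply: measurableT_comp => //.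
    by apply: measurableT_comp => //; exact: measurable_funM.
  move=> w _; rewrite -EFinM lee_fin indicE.
  case: (boolP (w \in A)) => [/set_mem/= wA|_]; last by rewrite mulr_ge0 ?expR_ge0.
  rewrite -expRD -[leLHS]expR0 ler_expR subr_ge0 ler_wpM2l ?(ltW hp)//.
  rewrite /U /y ler_pdivrMr//.
  have -> : M' * n%:R / (eps n ^+ 2 * m ^+ n) * m ^+ n = M' * n%:R / eps n ^+ 2.
    by field; rewrite !gt_eqF.
  by rewrite ler_pdivlMr ?exprn_gt0// mulrC; exact: ltW.
have LU : laplace P U h <= expR (- (c * (lam * n%:R))).
  by rewrite laplace_GW_Z// -hb; exact: dec.
apply: le_trans (_ : m `^ ((theta - 1) * n%:R) *
    (expR n%:R * expR (- (c * (lam * n%:R)))) <= _).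
  rewrite ler_wpM2l ?powR_ge0//; apply: le_trans PA _.
  by apply: ler_pM; rewrite ?expR_ge0 ?ler_expR ?fine_ge0// integral_ge0// => w _;
    rewrite lee_fin expR_ge0.
rewrite powRE// -!expRD ler_expR le_eqVlt; apply/orP; left; apply/eqP.
by rewrite /lam; field; rewrite gt_eqF.
Qed.

Hypothesis HX_law : forall k (B : set R), measurable B ->
  P (X k @^-1` B) = P (X 0%N @^-1` B).
Hypothesis HX1int : P.-integrable setT (EFin \o X 0%N).
Hypothesis HX1mean : (\int[P]_w (X 0%N w)%:E = 0)%E.
Hypothesis HX2int : P.-integrable setT (EFin \o (fun w => X 0%N w ^+ 2)).
Hypothesis Htail :
  (x `^ theta * fine (P [set w | x <= X 0%N w])) @[x --> +oo] --> a.

Lemma steps_independent : mutually_independent P X.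
Proof.
split=> [k|s B us mB]; first exact: (HY.1 (inr k)).
pose B' (i : ((nat * nat) + nat)%type) := if i is inr k then B k else setT.
have := HY.2 (map inr s) B'; rewrite !big_map; apply.
- by rewrite map_inj_uniq// => x y [].
- by move=> [[j l]|k] //=.
Qed.

Lemma psum_tail_asymptotics (e : R) : 0 < e ->
  exists2 M : R, 0 < M & forall k (x : R), (0 < k)%N -> M <= x ->
    M * k%:R * ln x <= x ^+ 2 ->
    `|x `^ theta * prob P [set w | x <= psum X k w] / k%:R - a| <= e.
Proof.
move=> e0.
apply: (@big_jump_asymptotics R (tail P X)
  (fun k x => prob P [set w | x <= psum X k w]) (second_moment P X) theta a) => //.
- by move=> x; exact: tail_ge0.
- by move=> x; exact: (tail_le1 steps_independent).
- exact: second_moment_ge0.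
- move=> k x delta eta h x0 d0 h0.
  by apply: psum_upper_bound => //; exact: steps_independent.
- move=> k x delta x0 d0.
  by apply: psum_lower_bound => //; exact: steps_independent.
Qed.

Local Notation rho n w := (((Z n w)%:R / m ^+ n) `^ (- (theta - 1))).
Let J n : R := fine (\int[P]_w (rho n w)%:E)%E.
Let event n := [set w | (0 < Z n w)%N /\
  (eps n <= psum X (Z n w) w / (Z n w)%:R)%R].
Let level n k : set R := [set y | (0 < k)%N /\ eps n <= y / k%:R].
Let H n k : R := prob P [set v | level n k (psum X k v)].

Let levelE n k : (0 < k)%N -> level n k = [set` `[eps n * k%:R, +oo[].
Proof.
move=> k0; apply/seteqP; split=> y /=; rewrite in_itv/= andbT.
  by move=> [_]; rewrite ler_pdivlMr// ltr0n.
by move=> h; split=> //; rewrite ler_pdivlMr// ltr0n.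
Qed.

Let measurable_level n k : measurable (level n k).
Proof.
case: k => [|k]; last by rewrite levelE//; exact: measurable_itv.
by rewrite (_ : level n 0%N = set0)//; apply/seteqP; split=> y // [].
Qed.

Let measurable_psum k : measurable_fun setT (psum X k).
Proof. by apply: measurable_sum => i; exact: steps_independent.1. Qed.

Let measurable_psum_level' n k : measurable [set v | level n k (psum X k v)].
Proof.
have := measurable_psum k measurableT (measurable_level n k).
by rewrite setTI.
Qed.

Lemma prob_eventE n : P (event n) = (\int[P]_w (H n (Z n w))%:E)%E.
Proof.
rewrite (GW_subst_psum HY n (measurable_level n)).
by apply: eq_integral => w _; apply: probE; exact: measurable_psum_level'.
Qed.

(** [H n k] is the conditional probability given [Z_n = k]. Off the small-population event [A] the
    one-big-jump estimate applies at [x = eps_n k]; on [A] the normalised probability is at most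
    [b], and [b] times the probability of [A] is negligible. *)
Lemma event_bounds (e : R) : 0 < e -> e < a ->
  exists N : nat, forall n, (N <= n)%N ->
  let b := m `^ ((theta - 1) * n%:R) in
  exists A : set T, [/\ measurable A, b * prob P A <= expR (- n%:R) &
    {ae P, forall w, eps n `^ theta * b * H n (Z n w) <= (a + e) * rho n w + b * \1_A w /\
      (a - e) * rho n w <= eps n `^ theta * b * H n (Z n w) + a * (b * \1_A w)}].
Proof.
move=> e0 ea; have apos := Ha; have th2 := Htheta; have mp := m0.
have [M M0 HM] := psum_tail_asymptotics e0.
have [M' M'0 [N1 HN1]] := good_region Hm1 b0 b1 Heps_pos Heps M0.
have [N2 HN2] := small_population_negligible M'0.
have [N3 HN3] := exprn2_eventually_ge M'0.
exists (maxn N1 (maxn N2 N3)) => n; rewrite !geq_max => /and3P[nN1 nN2 nN3] b.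
exists [set w | eps n ^+ 2 * (Z n w)%:R < M' * n%:R]; split.
- exact: measurable_small_population.
- exact: HN2.
apply: filterS (GW_Z_ge_ae n) => w; set k := Z n w => kge.
set A := [set w | _ < _].
have k0 : (0 < k)%N by apply: leq_trans kge; rewrite expn_gt0 (ltn_trans _ mu2).
have kr0 : 0 < k%:R :> R by rewrite ltr0n.
have mn0 := mX n.
have bE : b = (m ^+ n) `^ (theta - 1).
  by rewrite /b mulrC powRrM powR_mulrn ?(ltW mp).
have b00 : 0 < b by exact: powR_gt0.
have ep := Heps_pos n.
have rhoE : rho n w = b / k%:R `^ (theta - 1).
  rewrite -/k powRN powRM ?(ltW kr0) ?invr_ge0 ?(ltW mn0)// invfM bE mulrC.
  congr (_ * _); rewrite -[(m ^+ n)^-1]powR_inv1 ?(ltW mn0)//.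
  by rewrite powRAC powR_inv1 ?powR_ge0// invrK.
have rho0 : 0 < rho n w by rewrite powR_gt0// divr_gt0.
have rhob : rho n w <= b.
  rewrite rhoE ler_pdivrMr ?powR_gt0// ler_peMr ?(ltW b00)//.
  have := @ge0_ler_powR R (theta - 1) _ 1 k%:R; rewrite powR1; apply; rewrite ?nnegrE//.
    lra.
  by rewrite ler1n.
have H01 : 0 <= H n k <= 1.
  by rewrite prob_ge0/= prob_le1//; exact: measurable_psum_level'.
have {H01}/andP[H0 H1] := H01.
have [wA|wA] := ltP (eps n ^+ 2 * k%:R) (M' * n%:R).
  rewrite indicE mem_set//= mulr1.
  have ep1 : eps n <= 1.
    rewrite leNgt; apply/negP => ep1; move: wA; apply/negP; rewrite -leNgt.
    apply: le_trans (HN3 n nN3) _.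
    apply: le_trans (_ : k%:R <= _).
      rewrite -natrX ler_nat; apply: leq_trans kge.
      by case: (n) => [|n']; rewrite ?expn0// leq_exp2r.
    by rewrite ler_peMl ?(ltW kr0)// exprn_ege1// ltW.
  have epth : eps n `^ theta <= 1.
    have := @ge0_ler_powR R theta _ (eps n) 1; rewrite powR1; apply; rewrite ?nnegrE ?(ltW ep)//.
    lra.
  have BH : eps n `^ theta * b * H n k <= b.
    rewrite mulrAC -[leRHS]mul1r ler_wpM2r ?(ltW b00)//.
    by rewrite -[leRHS]mul1r ler_pM ?powR_ge0.
  have BH0 : 0 <= eps n `^ theta * b * H n k by rewrite !mulr_ge0 ?powR_ge0.
  split.
    have : 0 <= (a + e) * rho n w by rewrite mulr_ge0 ?(ltW rho0)//; lra.
    lra.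
  have : (a - e) * rho n w <= a * b.
    by apply: ler_pM => //; rewrite ?(ltW rho0)//; lra.
  lra.
rewrite indicE memNset/=; last by apply/negP; rewrite -leNgt.
rewrite !mulr0 !addr0.
have [Mx lnx] := HN1 n k nN1 k0 wA.
have := HM k (eps n * k%:R) k0 Mx lnx.
have -> : prob P [set v | eps n * k%:R <= psum X k v] = H n k.
  rewrite /H levelE//; congr prob; apply/seteqP; split=> v /=; by rewrite in_itv/= andbT.
have -> : (eps n * k%:R) `^ theta * H n k / k%:R =
    eps n `^ theta * (k%:R `^ (theta - 1)) * H n k.
  rewrite powRM ?(ltW ep) ?(ltW kr0)// -(mulr_powRB1 (ltW kr0)); last lra.
  by field; rewrite gt_eqF.
rewrite ler_norml => /andP[lo up].
(* [rho n w] is [b / k^(theta - 1)], so multiplying the estimate by it trades [k^(theta - 1)] for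
   the normalisation [b]. *)
have BE : eps n `^ theta * b * H n k =
    eps n `^ theta * (k%:R `^ (theta - 1)) * H n k * rho n w.
  by rewrite rhoE; field; rewrite gt_eqF// powR_gt0.
rewrite BE; split; rewrite ler_wpM2r ?(ltW rho0)//; lra.
Qed.

(** Integrating the almost sure bounds of [event_bounds] squeezes the normalised probability between
    [(a - e) J n] and [(a + e) J n], up to multiples of [exp(- n)]. *)
Lemma ratio_cvg (I : R) : J n @[n --> \oo] --> I ->
  (forall n, \int[P]_w (rho n w)%:E \is a fin_num)%E ->
  ((eps n `^ theta * m `^ ((theta - 1) * n%:R))%:E * P (event n))%E
    @[n --> \oo] --> (a * I)%:E.
Proof.
move=> JI Jfin; have apos := Ha.
have mH n : measurable_fun setT (fun w => H n (Z n w)).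
  exact: (measurableT_comp (f := H n)).
have mrho n : measurable_fun setT (fun w => rho n w).
  by apply: (measurableT_comp (measurable_powR _)); exact: measurable_funM.
have H0 n k : 0 <= H n k by exact: prob_ge0.
have mevent n : measurable (event n).
  rewrite (_ : event n = \bigcup_k (GW_Z xi n @^-1` [set k] `&`
      [set v | level n k (psum X k v)])).
    apply: bigcup_measurable => k _; apply: measurableI => //.
    by rewrite -[X in measurable X]setTI; apply: mZ.
  by apply/seteqP; split=> [w Dw|w [k _ [/= <-]]//]; exists (Z n w).
have pE n : (\int[P]_w (H n (Z n w))%:E = (prob P (event n))%:E)%E.
  by rewrite -prob_eventE probE.
have JE n : (\int[P]_w (rho n w)%:E = (J n)%:E)%E by rewrite fineK.
have bnd (e : R) : 0 < e -> e < a -> exists N : nat, forall n, (N <= n)%N ->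
    let u := eps n `^ theta * m `^ ((theta - 1) * n%:R) * prob P (event n) in
    u <= (a + e) * J n + expR (- n%:R) /\ (a - e) * J n <= u + a * expR (- n%:R).
  move=> e0 ea; have [N HN] := event_bounds e0 ea; exists N => n Nn u.
  have [A [mA PA aeA]] := HN n Nn.
  set b := m `^ ((theta - 1) * n%:R) in PA aeA u *.
  have b0' : 0 <= b by exact: powR_ge0.
  have B0 : 0 <= eps n `^ theta * b by rewrite mulr_ge0// powR_ge0.
  have mindic c : measurable_fun setT (fun w => (c * (b * \1_A w))%:E : \bar R).
    apply/measurable_EFinP; do 2?[apply: measurable_funM => //].
  have Iind (c : R) : 0 <= c ->
      (\int[P]_w (c * (b * \1_A w))%:E = (c * (b * prob P A))%:E)%E.
    move=> c0; under eq_integral do rewrite mulrA EFinM.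
    rewrite ge0_integralZl//; last 2 first.
    - by apply/measurable_EFinP; exact: measurable_indic.
    - by rewrite lee_fin mulr_ge0.
    by rewrite integral_indic// setIT mulrA [RHS]EFinM; congr (_ * _)%E; exact: probE.
  have IH : (\int[P]_w (eps n `^ theta * b * H n (Z n w))%:E = u%:E)%E.
    under eq_integral do rewrite EFinM.
    rewrite ge0_integralZl//; last 2 first.
    - by apply/measurable_EFinP; exact: mH.
    - by move=> w _; rewrite lee_fin.
    by rewrite pE -EFinM.
  have Irho (c : R) : 0 <= c -> (\int[P]_w (c * rho n w)%:E = (c * J n)%:E)%E.
    move=> c0; under eq_integral do rewrite EFinM.
    rewrite ge0_integralZl//; last 2 first.
    - by apply/measurable_EFinP; exact: mrho.
    - by move=> w _; rewrite lee_fin powR_ge0.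
    by rewrite JE -EFinM.
  have mBH : measurable_fun setT (fun w => (eps n `^ theta * b * H n (Z n w))%:E).
    by apply/measurable_EFinP; apply: measurable_funM => //; exact: mH.
  have mcrho c : measurable_fun setT (fun w => (c * rho n w)%:E).
    by apply/measurable_EFinP; apply: measurable_funM => //; exact: mrho.
  have ae0 : 0 <= a + e by lra.
  have ame0 : 0 <= a - e by lra.
  have a0 : 0 <= a by lra.
  split.
    rewrite -lee_fin -IH.
    apply: (@le_trans _ _ (\int[P]_w (((a + e) * rho n w)%:E + (1 * (b * \1_A w))%:E))%E).
      apply: ae_ge0_le_integral => //.
      - by move=> w _; rewrite lee_fin mulr_ge0.
      - by move=> w _; rewrite adde_ge0// lee_fin !mulr_ge0// powR_ge0.
      - exact: emeasurable_funD.
      - by apply: filterS aeA => w [up _] _; rewrite -EFinD lee_fin mul1r.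
    rewrite ge0_integralD//; last 2 first.
    - by move=> w _; rewrite lee_fin mulr_ge0// powR_ge0.
    - by move=> w _; rewrite lee_fin !mulr_ge0.
    by rewrite Irho// Iind// -EFinD lee_fin mul1r lerD2l.
  rewrite -lee_fin -Irho//.
  apply: (@le_trans _ _ (\int[P]_w ((eps n `^ theta * b * H n (Z n w))%:E + (a * (b * \1_A w))%:E))%E).
    apply: ae_ge0_le_integral => //.
    - by move=> w _; rewrite lee_fin mulr_ge0// powR_ge0.
    - by move=> w _; rewrite adde_ge0// lee_fin !mulr_ge0// powR_ge0.
    - exact: emeasurable_funD.
    - by apply: filterS aeA => w [_ lo] _; rewrite -EFinD lee_fin.
  rewrite ge0_integralD//; last 2 first.
  - by move=> w _; rewrite lee_fin mulr_ge0.
  - by move=> w _; rewrite lee_fin !mulr_ge0.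
  by rewrite IH Iind// -EFinD lee_fin lerD2l ler_wpM2l.
have J0 n : 0 <= J n.
  by apply: fine_ge0; apply: integral_ge0 => w _; rewrite lee_fin powR_ge0.
have I0 : 0 <= I.
  rewrite -(cvg_lim _ JI)//; apply: limr_ge; first exact: cvgP JI.
  exact: nearW.
have e0cvg : expR (- n%:R) @[n --> \oo] --> (0 : R).
  apply/cvgrPdist_le => t t0; have [N' HN'] := natr_eventually_ge t^-1.
  exists N' => // n /= Nn; rewrite sub0r normrN ger0_norm ?expR_ge0// expRN.
  rewrite -[leRHS]invrK lef_pV2 ?posrE ?invr_gt0 ?expR_gt0//.
  by apply: le_trans (HN' _ Nn) _; apply: le_trans (expR_ge1Dx _); rewrite lerDr.
suff main : eps n `^ theta * m `^ ((theta - 1) * n%:R) * prob P (event n)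
    @[n --> \oo] --> a * I.
  rewrite [X in X @ _ --> _](_ : _ = EFin \o (fun n =>
      eps n `^ theta * m `^ ((theta - 1) * n%:R) * prob P (event n))).
    by apply/fine_cvgP; split; [exact: nearW|exact: main].
  by apply/funext => n; rewrite /= [RHS]EFinM; congr (_ * _)%E; exact: probE.
apply/cvgrPdist_le => tol tol0.
(* The first entry ensures [e < a], the second [e I <= tol / 2]; [I + 1] keeps the denominator
   positive. *)
pose e := Num.min (a / 2) (tol / (2 * (I + 1))).
have I1 : 0 < 2 * (I + 1) by lra.
have e0 : 0 < e by rewrite lt_min !divr_gt0.
have ea : e < a by rewrite gt_min; apply/orP; left; lra.
have eI : e * I <= tol / 2.
  have : e * (2 * (I + 1)) <= tol by rewrite -ler_pdivlMr// ge_min lexx orbT.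
  lra.
have [N HN] := bnd e e0 ea.
have up : (a + e) * J n + expR (- n%:R) @[n --> \oo] --> (a + e) * I + 0.
  by apply: cvgD => //; apply: cvgMr.
have lo : (a - e) * J n - a * expR (- n%:R) @[n --> \oo] --> (a - e) * I - a * 0.
  by apply: cvgB; apply: cvgMr.
have tol2 : 0 < tol / 2 by rewrite divr_gt0.
have /cvgrPdist_le/(_ _ tol2) upn := up.
have /cvgrPdist_le/(_ _ tol2) lon := lo.
near=> n.
have Nn : (N <= n)%N by near: n; exact: nbhs_infty_ge.
have [u1 u2] := HN n Nn.
have : `|(a + e) * I + 0 - ((a + e) * J n + expR (- n%:R))| <= tol / 2 by near: n.
have : `|(a - e) * I - a * 0 - ((a - e) * J n - a * expR (- n%:R))| <= tol / 2 by near: n.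
rewrite !ler_norml => /andP[h1 h2] /andP[h3 h4]; apply/andP; split; lra.
Unshelve. all: by end_near.
Qed.

End ratio_asymptotics.

Theorem theorem4 (d : measure_display) (T : measurableType d) (R : realType)
  (P : probability T R)
  (p : nat -> R) (m : R) (mu : nat) (beta : R)
  (xi : nat -> nat -> T -> nat) (X : nat -> T -> R) (W : T -> R)
  (theta a : R) (eps : nat -> R)
  (* offspring law {p_k} *)
  (Hp0 : forall k, 0 <= p k)
  (Hpsum : (\sum_(k < n) p k) @[n --> \oo] --> (1 : R))
  (* mean m in (1, oo) *)
  (Hm : (\sum_(k < n) k%:R * p k) @[n --> \oo] --> m)
  (Hm1 : 1 < m)
  (* E Z_1 log Z_1 < oo *)
  (HLlogL : cvg ((\sum_(k < n) k%:R * ln k%:R * p k) @[n --> \oo]))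
  (* Boettcher case *)
  (Hbott : p 0%N = 0 /\ p 1%N = 0)
  (Hmu : 0 < p mu /\ (forall k, (k < mu)%N -> p k = 0))
  (Hbeta : mu%:R = m `^ beta)
  (* independence of all offspring counts and all steps X_k *)
  (Hindep : mutually_independent P
     (fun (i : ((nat * nat) + nat)%type) (w : T) =>
        match i with
        | inl (n, j) => (xi n j w)%:R
        | inr k => X k w
        end))
  (Hxi_law : forall n i k, P [set w | xi n i w = k] = (p k)%:E)
  (HX_law : forall k (B : set R), measurable B ->
     P (X k @^-1` B) = P (X 0%N @^-1` B))
  (* E X_1 = 0, E X_1^2 in (0, oo) *)
  (HX1int : P.-integrable setT (EFin \o X 0%N))
  (HX1mean : ('E_P[X 0%N] = 0)%E)
  (HX2int : P.-integrable setT (EFin \o (fun w => X 0%N w ^+ 2)))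
  (HX2pos : (0 < 'E_P[(fun w => X 0%N w ^+ 2)%R])%E)
  (* tail of index theta > 2 *)
  (Htheta : 2 < theta) (Ha : 0 < a)
  (Htail : (x `^ theta * fine (P [set w | x <= X 0%N w])) @[x --> +oo] --> a)
  (* W = lim m^{-n} Z_n a.s. *)
  (HWmeas : measurable_fun setT W)
  (HW : {ae P, forall w,
          ((GW_Z xi n w)%:R / m ^+ n) @[n --> \oo] --> W w})
  (* the sequence eps_n *)
  (Heps_pos : forall n, 0 < eps n)
  (Heps : (eps n * m `^ (n%:R / 2) * n%:R `^ (- (2 * beta)^-1))
            @[n --> \oo] --> +oo) :
  ((eps n `^ theta * m `^ ((theta - 1) * n%:R))%:E *
     P [set w | (0 < GW_Z xi n w)%N /\
                (eps n <= psum X (GW_Z xi n w) w / (GW_Z xi n w)%:R)%R])%E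
    @[n --> \oo] -->
  (a%:E * ((fine (Gamma_fun (theta - 1)))^-1%:E *
     \int[@lebesgue_measure R]_(v in `]0%R, +oo[)
        ('E_P[(fun w => expR (- v * W w))%R] * (v `^ (theta - 2))%:E)))%E.
Proof.
have X1mean : (\int[P]_w (X 0%N w)%:E = 0)%E by rewrite -HX1mean unlock.
have [I [IE Jfin JI]] := negative_moment_cvg Hp0 Hpsum Hm Hm1 HLlogL Hbott Hmu
  Hbeta Hindep Hxi_law Htheta HWmeas HW.
rewrite IE -EFinM.
exact: (ratio_cvg Hp0 Hpsum Hm Hm1 HLlogL Hbott Hmu Hbeta Hindep Hxi_law Htheta
  Ha Heps_pos Heps HX_law HX1int X1mean HX2int Htail JI Jfin).
Qed.
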